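(* Let $(G,B)$ be a connected finite graph with boundary equipped with the unit weight. For $i=2,3,\dots,|\Omega|$ and $j=1,2,\dots,i-1$, let $k=\left\lfloor\frac{|V|}{i-j+1}\right\rfloor$. Then: (1) when $(i-j+1)\nmid|V|$, $$\lambda_i\ge2\left(1-\cos\frac{\pi}{2k+1}\right)+\lambda_j(A_BL_B^{-1}A_\Omega);$$ (2) when $(i-j+1)\mid|V|$, $$\lambda_i\ge\lambda_1(P_{k+1},\{0\},m,w)+\lambda_j(A_BL_B^{-1}A_\Omega),$$ where $P_{k+1}$ is the path $0\sim1\sim2\sim\dots\sim k$ with boundary $\{0\}$, vertex-measure $m_l=1$ for $l=0,1,\dots,k$, and edge-weights $w_{12}=w_{23}=\dots=w_{k-1,k}=1$ and $w_{01}=\mu_{i-j+1}(P_{i-j+1})$, the largest Laplacian eigenvalue of the path $P_{i-j+1}$ on $i-j+1$ vertices equipped with the unit weight.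
   Context: A weighted finite graph $(G,m,w)$ is a finite simple graph $G$ with vertex set $V$ and edge set $E$, a vertex-measure $m:V\to(0,\infty)$ and an edge-weight $w:E\to(0,\infty)$; $w$ is extended to a symmetric function on $V\times V$ by $w_{xy}=0$ when $\{x,y\}\notin E$. The unit weight means $m\equiv1$ and $w\equiv1$ on $E$. A graph with boundary has in addition a nonempty subset $B\subset V$ (the boundary); $\Omega=V\setminus B$ is the interior. $\mathbb{R}^S$ is the space of real functions on $S$, with inner product $\langle u,v\rangle_S=\sum_{x\in S}u(x)v(x)m_x$. Laplacian: $\Delta u(x)=\frac1{m_x}\sum_{y\in V}(u(x)-u(y))w_{xy}$ for $u\in\mathbb{R}^V$; its eigenvalues, counted with multiplicity, are $0=\mu_1(G)\le\mu_2(G)\le\dots\le\mu_{|V|}(G)$. Dirichlet eigenvalues: for $u\in\mathbb{R}^\Omega$ let $E_0(u)\in\mathbb{R}^V$ be its extension by $0$ on $B$, and $\Delta^Du=(\Delta E_0(u))|_\Omega$, a nonnegative self-adjoint operator on $\mathbb{R}^\Omega$; its eigenvalues, counted with multiplicity, are $0\le\lambda_1\le\dots\le\lambda_{|\Omega|}$, also written $\lambda_i(G,B,m,w)$. Weighted adjacency operators: $A_B:\mathbb{R}^B\to\mathbb{R}^\Omega$, $A_Bu(x)=\frac1{m_x}\sum_{y\in B}u(y)w_{xy}$ for $x\in\Omega$, and $A_\Omega:\mathbb{R}^\Omega\to\mathbb{R}^B$, $A_\Omega u(x)=\frac1{m_x}\sum_{y\in\Omega}u(y)w_{xy}$ for $x\in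 B$. $L_B:\mathbb{R}^B\to\mathbb{R}^B$ is $L_Bf=(\Delta\tilde f)|_B$, where $\tilde f$ is the extension of $f$ by $0$ on $\Omega$; it is invertible when $G$ is connected and $\Omega\ne\emptyset$. For a self-adjoint operator $T$, $\lambda_1(T)\le\lambda_2(T)\le\cdots$ are its eigenvalues counted with multiplicity. *)

(* Defs.v *)
From HB Require Import structures.
From mathcomp Require Import all_boot all_order all_algebra.
From mathcomp Require Import boolp classical_sets reals trigo.

Set Implicit Arguments.
Unset Strict Implicit.
Unset Printing Implicit Defensive.

Import Order.TTheory GRing.Theory Num.Theory.

Local Open Scope ring_scope.

(* The space R^S of real functions on S; the regular module R^o gives it its
   finite-dimensional vector space structure. *)
Definition funs (R : realType) (S : finType) := {ffun S -> R^o}.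

Notation subV A := {x | x \in (A : {set _})} (only parsing).

Section Spectrum.
Context (R : realType) (U : vectType R).

(* For a self-adjoint operator the multiplicity of an eigenvalue is the
   dimension of its eigenspace.  These two conditions determine s. *)
Definition is_spectrum (f : 'End(U)) (s : seq R) : Prop :=
  sorted <=%R s /\ forall a : R, count_mem a s = \dim (passmx.leigenspace f a).

Definition spectrum (f : 'End(U)) : seq R :=
  xget [::] [set s : seq R | is_spectrum f s]%classic.

(* The i-th smallest eigenvalue; indices start at 1, and the value is
   meaningful for 1 <= i <= dim U. *)
Definition eigval (f : 'End(U)) (i : nat) : R := nth 0 (spectrum f) i.-1.

End Spectrum.

(* The operators depend on a weighted graph only through its vertex-measure m
   and its edge-weight w, extended by 0 to the pairs that are not edges. *)
Section Operators.
Context (R : realType) (V : finType).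
Implicit Types (A B : {set V}) (m : V -> R) (w : V -> V -> R).

Definition ext0 A (u : funs R (subV A)) : funs R V :=
  [ffun x => oapp u 0 (insub x)].

Definition restr A (u : funs R V) : funs R (subV A) :=
  [ffun x => u (val x)].

Definition lap_fun m w (u : funs R V) : funs R V :=
  [ffun x => (m x)^-1 * \sum_(y : V) (u x - u y) * w x y].

(* linfun turns a function that is linear into the corresponding linear map. *)
Definition lap m w : 'End(funs R V) := linfun (lap_fun m w).

Definition lap_on m w A : 'End(funs R (subV A)) :=
  linfun (fun u : funs R (subV A) => restr A (lap_fun m w (ext0 u))).

Definition dirichlet_lap m w B : 'End(funs R (subV (~: B))) :=
  lap_on m w (~: B).

Definition boundary_lap m w B : 'End(funs R (subV B)) := lap_on m w B.

Definition adj_boundary m w B : 'Hom(funs R (subV B), funs R (subV (~: B))) :=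
  linfun (fun u : funs R (subV B) =>
    [ffun x : subV (~: B) =>
       (m (val x))^-1 * \sum_(y : subV B) u y * w (val x) (val y)]
    : funs R (subV (~: B))).

Definition adj_interior m w B : 'Hom(funs R (subV (~: B)), funs R (subV B)) :=
  linfun (fun u : funs R (subV (~: B)) =>
    [ffun x : subV B =>
       (m (val x))^-1 * \sum_(y : subV (~: B)) u y * w (val x) (val y)]
    : funs R (subV B)).

(* A_B L_B^-1 A_Omega; the inverse of a linear map is the genuine one as soon
   as the map is invertible, which is the case of L_B here. *)
Definition schur_op m w B : 'End(funs R (subV (~: B))) :=
  (adj_boundary m w B \o (boundary_lap m w B)^-1 \o adj_interior m w B)%VF.

Definition mu m w (i : nat) : R := eigval (lap m w) i.

Definition lambdaD m w B (i : nat) : R := eigval (dirichlet_lap m w B) i.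

End Operators.

Section UnitWeight.
Context (R : realType) (V : Type).

Definition unit_measure : V -> R := fun=> 1.

Definition unit_weight (e : rel V) : V -> V -> R := fun x y => (e x y)%:R.

End UnitWeight.

Arguments unit_measure R V _ : clear implicits.

(* The path 0 ~ 1 ~ ... ~ n.-1 on n vertices. *)
Definition path_adj (n : nat) : rel 'I_n :=
  fun x y => (x.+1 == y :> nat) || (y.+1 == x :> nat).

Definition mu_path (R : realType) (n i : nat) : R :=
  mu (unit_measure R 'I_n) (unit_weight R (@path_adj n)) i.

(* The edge {0, 1} has weight c, every other edge has weight 1. *)
Definition path_weight (R : realType) (n : nat) (c : R) : 'I_n -> 'I_n -> R :=
  fun x y =>
    if path_adj x y then (if minn x y == 0%N then c else 1) else 0.

(* Main.v *)
(** In block form the Laplacian is [[D, -A_B], [-A_Omega, L_B]] with D the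
    Dirichlet Laplacian, so D - A_B L_B^-1 A_Omega is a Schur complement: its
    quadratic form at u is the energy on V of the extension of u that is harmonic
    on B.  Weyl's inequality then reduces both claims to finding, with n = i-j+1,
    a subspace of R^V of codimension at most n-1 on which
    energy >= beta * norm^2.

    That subspace comes from cutting G into connected pieces of bounded size,
    working from the leaves of a rooted decomposition, with one linear condition
    per cut: either u vanishes at the top vertex of a piece, or, when n divides
    |V| and all pieces have size exactly |V|/n, the two ends of the cut edge have a
    prescribed negative ratio, which splits the energy of that edge between the
    two pieces.  Sorting the values of |u| on a connected piece does not increase
    its energy, so a piece is compared with a path; the ratios are those of the
    top eigenvector of the path on n vertices. *)

Require Import Defs.
From HB Require Import structures.
From mathcomp Require Import all_boot all_order all_algebra.
From mathcomp Require Import boolp reals trigo complex.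
From mathcomp Require Import ring lra zify.

Set Implicit Arguments.
Unset Strict Implicit.
Unset Printing Implicit Defensive.

Import Order.TTheory GRing.Theory Num.Theory.

Local Open Scope ring_scope.

(** * Diagonalization of real symmetric matrices *)

(** Over [F[i]] the matrix is hermitian, so its minimal polynomial is a product of distinct linear
    factors with real roots. Minimal polynomials commute with field extension, so this also holds
    over [F]. *)
Lemma sym_mx_diagonalizable (F : rcfType) (n : nat) (A : 'M[F]_n) :
  A^T = A -> diagonalizable A.
Proof.
case: n A => [|n] A symA.
  by rewrite (flatmx0 A); apply: diagonalizable0.
pose C : numClosedFieldType := F[i]%C.
pose B : 'M[C]_n.+1 := map_mx (real_complex F) A.
have hB : B \is hermsymmx.
  apply: realsym_hermsym.
    by apply/is_hermitianmxP; rewrite expr0 scale1r map_mx_id // /B map_trmx symA.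
  by apply/mxOverP => i j; rewrite mxE complex_real.
have /mxOverP dR := hermitian_spectral_diag_real hB.
set d := spectral_diag B in dR.
have minB : mxminpoly B =
    map_poly (real_complex F)
      (\prod_(r <- undup [seq complex.Re (d 0 i) | i <- enum 'I_n.+1]) ('X - r%:P)).
  have eB : B = conjmx (invmx (spectralmx B)) (diag_mx d).
    rewrite conjVmx ?spectral_unit //.
    by have /orthomx_spectralP := hermitian_normalmx hB.
  rewrite eB mxminpoly_uconj ?unitmx_inv ?spectral_unit // mxminpoly_diag.
  rewrite rmorph_prod /=.
  under [RHS]eq_bigr do rewrite map_polyXsubC.
  rewrite -[RHS](big_map (real_complex F) predT (fun r => 'X - r%:P)).
  rewrite -(undup_map_inj (fmorph_inj (real_complex F))); congr (\prod_(r <- undup _) _).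
  rewrite -[RHS]map_comp; apply: eq_map => i /=; have := dR 0 i.
  by case: (d 0 i) => a b; rewrite realE !lecE /= (eq_sym 0 b) => /orP[] /andP[/eqP -> _].
apply/diagonalizableP; exists (undup [seq complex.Re (d 0 i) | i <- enum 'I_n.+1]).
  exact: undup_uniq.
by rewrite -(dvdp_map (real_complex F)) -minB -mxminpoly_map.
Qed.

(** * Self-adjoint operators and the min-max principle *)

Section SelfAdjoint.
Context (R : realType) (S : finType).
Implicit Types (u v : funs R S) (f : 'End(funs R S)) (W : {vspace funs R S}).

Definition dot u v : R := \sum_x u x * v x.

Lemma dotC u v : dot u v = dot v u.
Proof. by apply: eq_bigr => x _; rewrite mulrC. Qed.

Lemma dotDl u1 u2 v : dot (u1 + u2) v = dot u1 v + dot u2 v.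
Proof. by rewrite -big_split; apply: eq_bigr => x _; rewrite ffunE mulrDl. Qed.

Lemma dotDr u v1 v2 : dot u (v1 + v2) = dot u v1 + dot u v2.
Proof. by rewrite dotC dotDl !(dotC u). Qed.

Lemma dotZl a u v : dot (a *: u) v = a * dot u v.
Proof. by rewrite mulr_sumr; apply: eq_bigr => x _; rewrite ffunE mulrA. Qed.

Lemma dotZr a u v : dot u (a *: v) = a * dot u v.
Proof. by rewrite dotC dotZl dotC. Qed.

Lemma dot_ge0 u : 0 <= dot u u.
Proof. by apply: sumr_ge0 => x _; rewrite -expr2 sqr_ge0. Qed.

Lemma dot_eq0 u : (dot u u == 0) = (u == 0).
Proof.
apply/eqP/eqP => [|->]; last by rewrite /dot big1 // => x _; rewrite ffunE mul0r.
move/eqP; rewrite psumr_eq0 => [/allP u0|x _]; last by rewrite -expr2 sqr_ge0.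
apply/ffunP => x; rewrite ffunE; have := u0 x (mem_index_enum x).
by rewrite mulf_eq0 orbb => /eqP.
Qed.

Lemma dim_funs : \dim {:funs R S} = #|S|.
Proof. by rewrite dimvf /dim /= muln1. Qed.

Definition self_adjoint f := forall u v, dot (f u) v = dot u (f v).

Lemma leigenspaceP f a u :
  reflect (f u = a *: u) (u \in passmx.leigenspace f a).
Proof.
by rewrite memv_ker !lfun_simp subr_eq0; apply: eqP.
Qed.

(** In the basis of indicator functions [f] is a symmetric matrix [A] acting on row vectors. *)
Lemma eigenspaces_full f : self_adjoint f ->
  exists2 rs, uniq rs & (\sum_(a <- rs) passmx.leigenspace f a)%VS = fullv.
Proof.
move=> saf.
pose delta (x : S) : funs R S := [ffun y => (x == y)%:R].
have decomp u : u = \sum_x u x *: delta x.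
  apply/ffunP => y; rewrite sum_ffunE (bigD1 y) //= !ffunE eqxx.
  rewrite [_ *: _]mulr1 big1 ?addr0 // => x /negbTE ne.
  by rewrite !ffunE ne [_ *: _]mulr0.
have dot_delta u x : dot u (delta x) = u x.
  rewrite /dot (bigD1 x) //= ffunE eqxx mulr1 big1 ?addr0 // => y /negbTE.
  by rewrite eq_sym ffunE => ->; rewrite mulr0.
pose A : 'M[R]_#|S| := \matrix_(i, j) f (delta (enum_val i)) (enum_val j).
have [|rs rs_uniq rs_full] := (@diagonalizablePeigen _ _ A).1.
  apply: sym_mx_diagonalizable; apply/matrixP => i j.
  by rewrite !mxE -dot_delta saf dotC dot_delta.
exists rs => //; apply/vspaceP => u; rewrite memvf.
pose row_of u : 'rV[R]_#|S| := \row_i u (enum_val i).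
pose fun_of (v : 'rV[R]_#|S|) : funs R S := [ffun x => v 0 (enum_rank x)].
have row_ofK : cancel row_of fun_of.
  by move=> v; apply/ffunP => x; rewrite ffunE mxE enum_rankK.
have fun_ofK : cancel fun_of row_of.
  by move=> v; apply/rowP => i; rewrite mxE ffunE enum_valK.
have row_f v : row_of (f v) = row_of v *m A.
  apply/rowP => j; rewrite !mxE [in LHS](decomp v) linear_sum sum_ffunE.
  rewrite (reindex_onto enum_val enum_rank) => [|x _]; last exact: enum_rankK.
  rewrite (eq_bigl xpredT) => [|i]; last by rewrite enum_valK eqxx.
  by apply: eq_bigr => i _; rewrite !mxE linearZ ffunE.
have : (row_of u <= \sum_(r <- rs) eigenspace A r)%MS by rewrite rs_full submx1.
rewrite (big_nth 0) big_mkord => /sub_sumsmxP[w rowE].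
rewrite -[u]row_ofK rowE.
have -> : fun_of (\sum_(i < size rs) w i *m eigenspace A rs`_i) =
    \sum_(i < size rs) fun_of (w i *m eigenspace A rs`_i).
  apply/ffunP => x; rewrite sum_ffunE ffunE summxE.
  by apply: eq_bigr => i _; rewrite ffunE.
rewrite (big_nth 0) big_mkord; apply: memv_sumr => i _.
apply/leigenspaceP; apply: (can_inj row_ofK); rewrite row_f fun_ofK.
rewrite (eigenspaceP (submxMl _ _)); apply/rowP => j.
by rewrite [in RHS]mxE !ffunE !mxE enum_valK.
Qed.

Section Spectral.
Variable f : 'End(funs R S).
Hypothesis saf : self_adjoint f.
Local Notation E := (passmx.leigenspace f).

Lemma dot_eigen_sum a (rs : seq R) u v : a \notin rs ->
  u \in E a -> v \in (\sum_(b <- rs) E b)%VS -> dot u v = 0.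
Proof.
move=> + /leigenspaceP fu; elim: rs v => [|b rs IH] v.
  rewrite big_nil memv0 => _ /eqP ->.
  by rewrite /dot big1 // => x _; rewrite ffunE mulr0.
rewrite inE negb_or big_cons => /andP[ab ars] /memv_addP[v1 /leigenspaceP fv1].
case=> v2 v2rs ->; rewrite dotDr (IH v2) // addr0.
have := saf u v1; rewrite fu fv1 dotZl dotZr => /eqP.
by rewrite -subr_eq0 -mulrBl mulf_eq0 subr_eq0 (negbTE ab) => /eqP.
Qed.

Lemma dim_eigen_sum (rs : seq R) : uniq rs ->
  \dim (\sum_(b <- rs) E b)%VS = (\sum_(b <- rs) \dim (E b))%N.
Proof.
elim: rs => [|a rs IH] /=; first by rewrite !big_nil dimv0.
case/andP=> ars urs; rewrite !big_cons dimv_disjoint_sum ?IH //.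
apply/eqP; rewrite -subv0; apply/subvP => u; rewrite memv_cap memv0.
by case/andP=> ua urs'; rewrite -dot_eq0 (dot_eigen_sum ars ua urs').
Qed.

(** The sign [s] will be 1 or -1, so that one induction gives the lower bound for eigenvalues above
    [l] and the upper bound for those below. *)
Lemma quad_eigen_sum (s l : R) (rs : seq R) u : uniq rs ->
  (forall b, b \in rs -> 0 <= s * (b - l)) ->
  u \in (\sum_(b <- rs) E b)%VS -> 0 <= s * (dot (f u) u - l * dot u u).
Proof.
elim: rs u => [|a rs IH] u /=.
  rewrite big_nil memv0 => _ _ /eqP ->.
  by rewrite linear0 /dot big1 ?mulr0 ?subrr ?mulr0 // => x _; rewrite ffunE mulr0.
case/andP=> ars urs hl; rewrite big_cons => /memv_addP[v va [w wrs ->]].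
have vw := dot_eigen_sum ars va wrs; have wv := vw; rewrite dotC in wv.
have fwv : dot (f w) v = 0 by rewrite saf (leigenspaceP _ _ _ va) dotZr wv mulr0.
have hw : 0 <= s * (dot (f w) w - l * dot w w).
  by apply: IH => // b brs; apply: hl; rewrite inE brs orbT.
have ha := hl a (mem_head _ _).
rewrite linearD /= !(dotDl, dotDr) vw wv fwv (leigenspaceP _ _ _ va) !dotZl vw.
have : 0 <= s * (a - l) * dot v v by rewrite mulr_ge0 ?dot_ge0.
lra.
Qed.

(** [spectrum] is a choice with default [[::]], so a witness is needed: each eigenvalue repeated as
    often as the dimension of its eigenspace. A value outside [rs] has an eigenspace orthogonal to
    everything, hence trivial. *)
Lemma spectrumP : is_spectrum f (spectrum f).
Proof.
suff [s hs] : exists s, is_spectrum f s by apply: (classical_sets.xgetPex [::]); exists s.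
have [rs urs rs_full] := eigenspaces_full saf.
exists (sort <=%R (flatten [seq nseq (\dim (E a)) a | a <- rs])); split.
  exact: sort_le_sorted.
move=> a; rewrite count_sort count_flatten -map_comp sumnE big_map.
have [ars|ars] := boolP (a \in rs).
  rewrite (bigD1_seq a) //= count_nseq /= eqxx mul1n big1 ?addn0 // => b /negbTE ab.
  by rewrite /= count_nseq /= ab.
rewrite big1_seq => [|b /= brs]; last first.
  by rewrite count_nseq /=; case: eqP => // ba; rewrite -ba brs in ars.
apply/esym/eqP; rewrite dimv_eq0 -subv0; apply/subvP => u ua.
by rewrite memv0 -dot_eq0 (dot_eigen_sum ars ua) // rs_full memvf.
Qed.

Lemma dim_spectral (P : pred R) :
  \dim (\sum_(b <- undup [seq a <- spectrum f | P a]) E b)%VS =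
  count P (spectrum f).
Proof.
have [_ cnt] := spectrumP.
rewrite dim_eigen_sum ?undup_uniq // -filter_undup big_filter.
under eq_bigr do rewrite -cnt.
rewrite -sum1_count -(big_undup_iterop_count _ _ _ (fun=> 1%N)).
by apply: eq_bigr => a _; rewrite Monoid.iteropE iter_addn_0 mul1n.
Qed.

Lemma size_spectrum : size (spectrum f) = #|S|.
Proof.
have [_ cnt] := spectrumP; rewrite -count_predT -dim_spectral -dim_funs.
congr (\dim _); have [rs _ rs_full] := eigenspaces_full saf.
apply/eqP; rewrite eqEsubv subvf /= -rs_full filter_predT.
apply: (big_ind (fun V => V <= _)%VS) => [|V1 V2|b _]; first exact: sub0v.
  by rewrite subv_add => -> ->.
have [bs|/count_memPn] := boolP (b \in spectrum f).
  by rewrite (bigD1_seq b) ?undup_uniq ?mem_undup //= addvSl.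
by rewrite cnt => /eqP; rewrite dimv_eq0 => /eqP ->; apply: sub0v.
Qed.

Lemma spectrum_homo i j : (i <= j)%N -> (j < #|S|)%N ->
  nth 0 (spectrum f) i <= nth 0 (spectrum f) j.
Proof.
have [srt _] := spectrumP; move=> ij j_lt.
by apply: (sorted_leq_nth le_trans lexx) => //; rewrite inE size_spectrum; lia.
Qed.

(** The witness sums the eigenspaces for eigenvalues at least [eigval f i]; all entries of the
    spectrum from position [i.-1] on qualify. *)
Lemma eigval_lower_subspace i : (0 < i <= #|S|)%N ->
  exists W, (#|S| <= \dim W + i.-1)%N /\
    forall u, u \in W -> eigval f i * dot u u <= dot (f u) u.
Proof.
case/andP=> i_gt0 i_le; pose l := eigval f i.
pose P := [pred a | l <= a].
exists (\sum_(b <- undup [seq a <- spectrum f | P a]) E b)%VS; split.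
  have : count P (drop i.-1 (spectrum f)) = (#|S| - i.-1)%N.
    rewrite -size_spectrum -size_drop; apply/eqP; rewrite -all_count.
    apply/(all_nthP 0) => m; rewrite size_drop => m_lt; rewrite nth_drop /=.
    by apply: spectrum_homo; rewrite ?leq_addr //; rewrite size_spectrum in m_lt; lia.
  have := congr1 (count P) (cat_take_drop i.-1 (spectrum f)).
  rewrite count_cat dim_spectral => <- ->; lia.
move=> u uW; rewrite -subr_ge0 -[_ - _]mul1r.
apply: quad_eigen_sum uW; rewrite ?undup_uniq // => b.
by rewrite mem_undup mem_filter mul1r subr_ge0 => /andP[].
Qed.

(** Courant-Fischer: the eigenspaces for eigenvalues at most [eigval f i] span dimension at least
    [i], so they meet [W] in a nonzero vector, whose Rayleigh quotient lies between [c] and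
    [eigval f i]. *)
Lemma eigval_ge i c W : (0 < i <= #|S|)%N -> (#|S| <= \dim W + i.-1)%N ->
  (forall u, u \in W -> c * dot u u <= dot (f u) u) -> c <= eigval f i.
Proof.
case/andP=> i_gt0 i_le dimW hW; pose l := eigval f i.
pose P := [pred a | a <= l].
pose W' := (\sum_(b <- undup [seq a <- spectrum f | P a]) E b)%VS.
have dimW' : (i <= \dim W')%N.
  have : count P (take i (spectrum f)) = i.
    have s_take : size (take i (spectrum f)) = i by rewrite size_takel ?size_spectrum.
    rewrite -[RHS]s_take; apply/eqP; rewrite -all_count.
    apply/(all_nthP 0) => m; rewrite s_take => m_lt; rewrite nth_take //=.
    by apply: spectrum_homo; lia.
  have := congr1 (count P) (cat_take_drop i (spectrum f)).
  rewrite count_cat dim_spectral => <- ->; lia.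
have : (W :&: W')%VS != 0%VS.
  rewrite -dimv_eq0 -lt0n; have := dimvS (subvf (W + W')); rewrite dim_funs.
  move: (dimv_sum_cap W W') dimW dimW' i_gt0.
  move: (\dim (W + W')) (\dim (W :&: W')) (\dim W) (\dim W') #|S| => a b c' d n.
  lia.
rewrite -vpick0; set u := vpick _ => u0.
have /andP[uW uW'] : (u \in W) && (u \in W') by rewrite -memv_cap memv_pick.
have u_gt0 : 0 < dot u u by rewrite lt0r dot_eq0 u0 dot_ge0.
have : 0 <= -1 * (dot (f u) u - l * dot u u).
  apply: quad_eigen_sum uW'; rewrite ?undup_uniq // => b.
  by rewrite mem_undup mem_filter mulN1r oppr_ge0 subr_le0 => /andP[].
rewrite mulN1r oppr_ge0 subr_le0 => /(le_trans (hW u uW)).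
by rewrite ler_pM2r.
Qed.

Lemma eigval_eigenvector i : (0 < i <= #|S|)%N ->
  exists2 u, u != 0 & f u = eigval f i *: u.
Proof.
case/andP=> i_gt0 i_le; have [_ cnt] := spectrumP.
have : eigval f i \in spectrum f by rewrite mem_nth // size_spectrum; lia.
rewrite -has_pred1 has_count cnt lt0n dimv_eq0 -vpick0 => u0.
by exists (vpick (E (eigval f i))) => //; apply/leigenspaceP; apply: memv_pick.
Qed.

End Spectral.
End SelfAdjoint.

(** * Energy of a connected vertex set and its rearrangement on a path *)

Section Graph.
Context (R : realType) (V : finType) (e : rel V).
Hypothesis e_sym : symmetric e.
Implicit Types (C D : {set V}) (u p : V -> R) (v : nat -> R).

Definition energy C u : R :=
  2^-1 * \sum_(x in C) \sum_(y in C) (e x y)%:R * (u x - u y) ^+ 2.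

Definition sqnorm C u : R := \sum_(x in C) u x ^+ 2.

Definition connected C : Prop :=
  forall S : {set V}, S \subset C -> S != set0 -> S != C ->
  exists x y, [/\ x \in S, y \in C :\: S & e x y].

(* Vertex 0 of the path carries the value 0 and is left out: v l is the value at
   the vertex l.+1, and c is the weight of the edge {0, 1}. *)
Definition path_energy (c : R) k v : R :=
  c * v 0%N ^+ 2 + \sum_(0 <= l < k.-1) (v l.+1 - v l) ^+ 2.

(** For positive [k]: [b] is at most the first Dirichlet eigenvalue of this path with [k] free
    vertices. *)
Definition path_bound (c : R) k (b : R) : Prop :=
  forall v, b * \sum_(0 <= l < k) v l ^+ 2 <= path_energy c k v.

Lemma sum_sqr_increments v i j : {in gtn j.+1 &, {homo v : a b / (a <= b)%N >-> a <= b}} ->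
  (i <= j)%N -> \sum_(i <= l < j) (v l.+1 - v l) ^+ 2 <= (v j - v i) ^+ 2.
Proof.
elim: j => [|j IH] mono; first by rewrite leqn0 => /eqP ->; rewrite big_geq // subrr expr0n.
rewrite leq_eqVlt => /predU1P[-> |ij]; first by rewrite big_geq // subrr expr0n.
rewrite big_nat_recr //=; set a := \sum_(_ <= _ < _) _.
have ha : a <= (v j - v i) ^+ 2.
  by apply: IH => // x y; rewrite !inE => xj yj; apply: mono; rewrite inE; lia.
have h1 : v i <= v j by apply: mono; rewrite ?inE //; lia.
have h2 : v j <= v j.+1 by apply: mono; rewrite ?inE //; lia.
nra.
Qed.

(* v lists the values of |u| on D in increasing order.  Every cut of that list is
   crossed by an edge of D, and squares are superadditive on nonnegative
   increments. *)
Lemma rearrangement D u p : connected D -> D != set0 ->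
  {in D, forall x, 0 <= p x} ->
  exists v, [/\ sqnorm D u = \sum_(0 <= l < #|D|) v l ^+ 2,
    path_energy (\sum_(x in D) p x) #|D| v
      <= energy D u + \sum_(x in D) p x * u x ^+ 2 &
    {in D, forall x, v 0%N ^+ 2 <= u x ^+ 2}].
Proof.
move=> connD /set0Pn[x0 x0D] p_ge0.
pose r := relpre (fun x => `|u x|) (<=%R : rel R).
pose vs := sort r (enum D); pose s := #|D|.
have vs_size : size vs = s by rewrite size_sort -cardE.
have vs_mem x : (x \in vs) = (x \in D) by rewrite mem_sort mem_enum.
have s_gt0 : (0 < s)%N by rewrite lt0n cards_eq0; apply/set0Pn; exists x0.
pose vx i := nth x0 vs i; pose v i := `|u (vx i)|.
have vxD i : (i < s)%N -> vx i \in D by move=> i_lt; rewrite -vs_mem mem_nth ?vs_size.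
have sumE (F : V -> R) : \sum_(x in D) F x = \sum_(0 <= i < s) F (vx i).
  by rewrite -big_enum -(perm_big _ (permEl (perm_sort r _))) (big_nth x0) vs_size.
have mono i j : (i <= j)%N -> (j < s)%N -> v i <= v j.
  move=> ij js; apply: (sorted_leq_nth (leT := r)); rewrite ?inE ?vs_size //.
  - by move=> y x z; apply: le_trans.
  - by move=> x; apply: lexx.
  - by apply: sort_sorted => x y; apply: le_total.
  - by lia.
pose d l := (v l.+1 - v l) ^+ 2.
(* Indicator that the gap between positions [l] and [l.+1] lies between position [i] and a later
   position [j]. *)
pose cr (l i j : nat) : R := ((i <= l) && (l < j))%N%:R.
have d_ge0 l : 0 <= d l by apply: sqr_ge0.
have diff_le i j : (i <= j)%N -> (j < s)%N ->
    \sum_(0 <= l < s.-1) cr l i j * d l <= (v j - v i) ^+ 2.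
  move=> ij js; apply: le_trans (sum_sqr_increments _ ij); last first.
    by move=> a b; rewrite !inE => *; apply: mono => //; lia.
  rewrite [leRHS](big_nat_widen _ _ s.-1); last by lia.
  rewrite [leRHS](big_nat_widenl _ 0) // [leRHS]big_mkcond /=; apply: ler_sum => l _.
  by rewrite /cr andbC; case: ifP => _; rewrite ?mul1r ?mul0r.
(* The first [l.+1] positions form a proper nonempty part of [D], so an edge leaves it. *)
have crossing l : (l < s.-1)%N -> exists i j,
    [/\ (i < s)%N, (j < s)%N, e (vx i) (vx j) & cr l i j = 1].
  move=> l_lt; have [|||z [y [zS]]] := connD [set x in D | (index x vs <= l)%N].
  - by apply/subsetP => x; rewrite inE => /andP[].
  - apply/set0Pn; exists (vx 0%N); rewrite inE vxD //=.
    by rewrite index_uniq ?vs_size // sort_uniq enum_uniq.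
  - apply/eqP => /setP/(_ (vx l.+1)); rewrite inE vxD; last by lia.
    by rewrite index_uniq ?vs_size ?sort_uniq ?enum_uniq ?ltnn //; lia.
  move: zS; rewrite !inE => /andP[zD zl] /andP[+ yD] ezy; rewrite yD /= -ltnNge => ly.
  exists (index z vs), (index y vs).
  rewrite /vx !nth_index ?vs_mem // -!vs_size !index_mem !vs_mem zD yD; split => //.
  by rewrite /cr zl ly.
exists v; split.
- by rewrite [LHS]sumE; apply: eq_bigr => i _; rewrite /v real_normK // num_real.
- rewrite /path_energy addrC lerD //; last first.
    (* The whole potential moves to the vertex where [|u|] is smallest. *)
    rewrite mulr_suml; apply: ler_sum => x xD; rewrite ler_wpM2l ?p_ge0 //.
    rewrite -[leRHS]real_normK ?num_real // lerXn2r ?nnegrE ?normr_ge0 //.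
    have ix : (index x vs < s)%N by rewrite -vs_size index_mem vs_mem.
    by have := mono 0%N _ (leq0n _) ix; rewrite /v /vx nth_index ?vs_mem.
  have -> : energy D u = 2^-1 * \sum_(0 <= i < s) \sum_(0 <= j < s)
      (e (vx i) (vx j))%:R * (u (vx i) - u (vx j)) ^+ 2.
    by congr (_ * _); rewrite [LHS]sumE; apply: eq_bigr => i _; apply: sumE.
  pose E i j : R := (e (vx i) (vx j))%:R.
  have cross_ge i j : (i < s)%N -> (j < s)%N ->
      \sum_(0 <= l < s.-1) E i j * (cr l i j + cr l j i) * d l
        <= E i j * (u (vx i) - u (vx j)) ^+ 2.
    move=> i_lt j_lt; under eq_bigr do rewrite -mulrA.
    rewrite -mulr_sumr ler_wpM2l ?ler0n //.
    apply: (@le_trans _ _ ((v j - v i) ^+ 2)).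
      under eq_bigr do rewrite mulrDl.
      rewrite big_split /=.
      wlog ij : i j i_lt j_lt / (i <= j)%N.
        move=> wl; case/orP: (leq_total i j) => ij; first exact: wl.
        by rewrite addrC -[leRHS]sqrrN opprB; apply: wl.
      rewrite [X in _ + X]big1 ?addr0 ?diff_le // => l _.
      by rewrite /cr [_ && _](_ : _ = false) ?mul0r //; apply/negP; lia.
    rewrite -[leLHS]real_normK ?num_real // -[leRHS]real_normK ?num_real //.
    by rewrite lerXn2r ?nnegrE // [leLHS]distrC ler_dist_dist.
  have -> : \sum_(0 <= l < s.-1) (v l.+1 - v l) ^+ 2 =
      2^-1 * \sum_(0 <= l < s.-1) 2 * d l.
    by rewrite -mulr_sumr mulrA mulVf ?mul1r ?pnatr_eq0.
  rewrite ler_pM2l ?invr_gt0 //.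
  apply: (@le_trans _ _ (\sum_(0 <= i < s) \sum_(0 <= j < s)
      \sum_(0 <= l < s.-1) E i j * (cr l i j + cr l j i) * d l)); last first.
    rewrite !big_mkord; apply: ler_sum => i _.
    by rewrite !big_mkord; apply: ler_sum => j _; rewrite cross_ge.
  under [leRHS]eq_bigr do rewrite exchange_big.
  rewrite exchange_big /= !big_mkord; apply: ler_sum => l _.
  under eq_bigr do rewrite -mulr_suml.
  rewrite -mulr_suml ler_wpM2r //.
  (* The ordered double sum meets an edge across the gap [l] in both orientations, so [d l] has
     coefficient at least 2, which matches the halving in [energy]. *)
  have [i [j [i_lt j_lt eij cij]]] := crossing l (ltn_ord l).
  have single a b : (a < s)%N -> (b < s)%N -> e (vx a) (vx b) ->
     forall F : nat -> nat -> R, (forall x y, 0 <= F x y) -> F a b = 1 ->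
     1 <= \sum_(0 <= x < s) \sum_(0 <= y < s) E x y * F x y.
    move=> a_lt b_lt eab F F_ge0 Fab; rewrite big_mkord (bigD1 (Ordinal a_lt)) //=.
    rewrite big_mkord (bigD1 (Ordinal b_lt)) //= Fab /E eab mulr1 -addrA lerDl.
    have ge0 x y : 0 <= E x y * F x y by rewrite mulr_ge0 ?ler0n.
    rewrite addr_ge0 ?sumr_ge0 // => x _; first exact: ge0.
    by apply: sumr_ge0 => y _; apply: ge0.
  have cr_ge0 x y z : 0 <= cr x y z by rewrite ler0n.
  under eq_bigr do [under eq_bigr do rewrite mulrDr; rewrite big_split].
  rewrite big_split /= -[2]/(1 + 1) lerD //.
    exact: (single i j _ _ _ (fun x y => cr l x y)).
  by apply: (single j i _ _ _ (fun x y => cr l y x)) => //; rewrite e_sym.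
- move=> x xD; rewrite -[leRHS]real_normK ?num_real // lerXn2r ?nnegrE ?normr_ge0 //.
  have ix : (index x vs < s)%N by rewrite -vs_size index_mem vs_mem.
  by have := mono 0%N _ (leq0n _) ix; rewrite /v /vx nth_index ?vs_mem.
Qed.

End Graph.

(** * Monotonicity of path bounds *)

Section PathBound.
Context (R : realType).
Implicit Types (v : nat -> R) (b c : R) (k : nat).

(** Continuing [v] by its last value keeps the energy and can only increase the norm. *)
Lemma path_bound_shrink c k k' b : 0 <= b -> (0 < k' <= k)%N ->
  path_bound c k b -> path_bound c k' b.
Proof.
move=> b_ge0 /andP[k'_gt0 k'_le] hk v.
have := hk (fun l => v (minn l k'.-1)); rewrite /path_energy min0n => hv.
apply: le_trans (le_trans hv _).
  rewrite ler_wpM2l // [leRHS](big_cat_nat _ (n := k')) //= ?leq0n //.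
  rewrite ler_wpDr ?sumr_ge0 // => [l _|]; first by rewrite sqr_ge0.
  apply: ler_sum_nat => l l_lt.
  by rewrite (minn_idPl _) //; lia.
rewrite lerD2l [leLHS](big_cat_nat _ (n := k'.-1)) //=; last by lia.
rewrite [X in _ + X]big_nat [X in _ + X]big1 ?addr0 => [|l l_ge].
  apply: ler_sum_nat => l l_lt.
  by rewrite !(minn_idPl _) //; lia.
by rewrite !(minn_idPr _) ?subrr ?expr0n //; lia.
Qed.

(** A test function vanishing at the first free vertex puts no energy on the edge of weight [c]; the
    next edge, of weight 1, takes its place. *)
Lemma path_bound_shift c k b : path_bound c k.+1 b -> path_bound 1 k b.
Proof.
move=> hk v; have := hk (fun l => if l is l'.+1 then v l' else 0).
rewrite /path_energy /= big_nat_recl //= !expr0n /= mulr0 !add0r.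
case: k {hk} => [|k]; first by rewrite !big_geq // mulr0 => _; rewrite mul1r addr0 sqr_ge0.
by rewrite [X in _ <= X -> _]big_nat_recl //= subr0 mul1r.
Qed.

End PathBound.

(** * Bounds on connected sets and removal of a branch *)

Section Connected.
Context (R : realType) (V : finType) (e : rel V).
Hypothesis e_sym : symmetric e.
Implicit Types (C D : {set V}) (u p : V -> R) (v : nat -> R).
Local Notation energy := (energy e).
Local Notation connected := (connected e).

Lemma connected_bound c k b D u p : 0 <= b -> path_bound c k b ->
  connected D -> (0 < #|D| <= k)%N -> {in D, forall x, 0 <= p x} ->
  c <= \sum_(x in D) p x ->
  b * sqnorm D u <= energy D u + \sum_(x in D) p x * u x ^+ 2.
Proof.
move=> b_ge0 hk connD D_le p_ge0 c_le; have /andP[D_gt0 _] := D_le.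
have D_neq0 : D != set0 by rewrite -card_gt0.
have [v [-> hv _]] := rearrangement e_sym u connD D_neq0 p_ge0.
apply: le_trans (path_bound_shrink b_ge0 D_le hk v) (le_trans _ hv).
by rewrite lerD2r ler_wpM2r ?sqr_ge0.
Qed.

(** The sorted list now starts with 0, so the other values, at most [k.-1] of them, live on a path
    whose first edge has weight 1. *)
Lemma connected_bound0 k b D u x : 0 <= b -> path_bound 1 k.-1 b ->
  connected D -> (#|D| <= k)%N -> x \in D -> u x = 0 ->
  b * sqnorm D u <= energy D u.
Proof.
move=> b_ge0 hk connD D_le xD ux0; have D_neq0 : D != set0 by apply/set0Pn; exists x.
have [|v [-> hv v0]] := @rearrangement _ _ _ e_sym D u (fun=> 0) connD D_neq0; first by [].
have {v0}v0 : v 0%N = 0.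
  by have := v0 x xD; rewrite ux0 expr0n /= le_eqVlt ltNge sqr_ge0 orbF sqrf_eq0 => /eqP.
move: hv; rewrite (big1 _ _ _ (fun y _ => mul0r _)) addr0; apply: le_trans.
rewrite /path_energy v0 expr0n mulr0 add0r.
move: D_neq0; rewrite -card_gt0; case: #|D| D_le => // s s_le _.
rewrite big_nat_recl //= v0 expr0n add0r; case: s s_le => [|s] s_le.
  by rewrite !big_geq // mulr0.
rewrite [leRHS]big_nat_recl //= v0 subr0 -[X in _ <= X + _]mul1r.
apply: (path_bound_shrink b_ge0 _ hk (fun l => v l.+1)); lia.
Qed.

Lemma connected_setU C1 C2 x y : connected C1 -> connected C2 ->
  x \in C1 -> y \in C2 -> e x y -> connected (C1 :|: C2).
Proof.
move=> conn1 conn2 xC1 yC2 exy S SC S0 SU.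
have sub1 : S :&: C1 \subset C1 by apply: subsetIr.
have sub2 : S :&: C2 \subset C2 by apply: subsetIr.
have step C : C \subset C1 :|: C2 -> connected C -> S :&: C != set0 -> S :&: C != C ->
    exists a b, [/\ a \in S, b \in (C1 :|: C2) :\: S & e a b].
  move=> CU conn SC0 SCC; have [a [b []]] := conn _ (subsetIr S C) SC0 SCC.
  rewrite !inE => /andP[aS aC] /andP[bN bC] eab; exists a, b; split => //.
  rewrite !inE; move: bN; rewrite bC andbT => -> /=.
  by have := subsetP CU _ bC; rewrite inE.
have [E1|N1] := eqVneq (S :&: C1) set0; have [E2|N2] := eqVneq (S :&: C2) set0.
- by case/negP: S0; rewrite -(setIidPl SC) setIUr E1 E2 setU0.
- have [F2|M2] := eqVneq (S :&: C2) C2; last by apply: (step C2); rewrite ?subsetUr.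
  exists y, x; rewrite e_sym exy !inE xC1 andbT; split => //.
    by move/setIidPr/subsetP : F2; apply.
  by apply/negP => xS; have := in_set0 x; rewrite -E1 inE xS xC1.
- have [F1|M1] := eqVneq (S :&: C1) C1; last by apply: (step C1); rewrite ?subsetUl.
  exists x, y; rewrite exy !inE yC2 orbT andbT; split => //.
    by move/setIidPr/subsetP : F1; apply.
  by apply/negP => yS; have := in_set0 y; rewrite -E2 inE yS yC2.
- have [F1|M1] := eqVneq (S :&: C1) C1; last by apply: (step C1); rewrite ?subsetUl.
  have [F2|M2] := eqVneq (S :&: C2) C2; last by apply: (step C2); rewrite ?subsetUr.
  by case/negP: SU; rewrite -[S](setIidPl SC) setIUr F1 F2.
Qed.

Lemma connected1 x : connected [set x].
Proof. by move=> S; rewrite subset1 => /orP[] /eqP -> /eqP // _ /eqP. Qed.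

(** [C2] is a maximal connected subset of [C] without [r]. All edges from it to the rest of [C] end
    at [r], so cutting it off leaves a connected set. *)
Lemma connected_split C r : connected C -> r \in C -> C != [set r] ->
  exists C1 C2 z, [/\ [/\ C = C1 :|: C2, [disjoint C1 & C2] & r \in C1],
    z \in C2, e r z, connected C1 & connected C2].
Proof.
move=> connC rC Cr.
have [x xC xr] : exists2 x, x \in C & x != r.
  have [C0|[x]] := set_0Vmem (C :\ r); last by rewrite !inE => /andP[xr xC]; exists x.
  by case/eqP: Cr; rewrite -(setD1K rC) C0 setU0.
pose P (S : {set V}) := `[< S \subset C :\ r /\ connected S >].
have Px : P [set x].
  by apply/asboolP; split; [rewrite sub1set !inE xr | apply: connected1].
have [C2 /maxsetP[/asboolP[C2C conn2] C2max] xC2] := maxset_exists Px.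
rewrite sub1set in xC2.
have rC2 : r \notin C2 by apply/negP => /(subsetP C2C); rewrite !inE eqxx.
have C2subC : C2 \subset C by apply: subset_trans C2C (subsetDl _ _).
have isolated y w : y \in C :\: C2 -> w \in C2 -> e w y -> y = r.
  rewrite !inE => /andP[yC2 yC] wC2 ewy; apply/eqP/negPn/negP => yr.
  have : C2 :|: [set y] = C2.
    apply: C2max (subsetUl _ _); apply/asboolP; split.
      by rewrite subUset C2C sub1set !inE yr.
    exact: (connected_setU conn2 (@connected1 y) wC2 (set11 y) ewy).
  by move/setP/(_ y); rewrite !inE eqxx orbT (negbTE yC2).
have [z [y [zC2 yC ezy]]] : exists a b, [/\ a \in C2, b \in C :\: C2 & e a b].
  apply: connC => //; first by apply/set0Pn; exists x.
  by apply/eqP => E; rewrite E rC in rC2.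
have yr := isolated _ _ yC zC2 ezy; subst y.
exists (C :\: C2), C2, z; split => //; last 2 first.
- by rewrite e_sym.
- move=> S SC S0 SN.
  have main (T : {set V}) : T \subset C :\: C2 -> T != set0 -> r \notin T ->
      exists a b, [/\ a \in T, b \in (C :\: C2) :\: T & e a b].
    move=> TC T0 rT; have [||a [b [aT bT eab]]] := connC T _ T0.
    - by apply: subset_trans TC (subsetDl _ _).
    - by apply/eqP => E; rewrite E rC in rT.
    exists a, b; split => //; move: bT; rewrite !inE => /andP[-> bC]; rewrite bC andbT /=.
    apply/negP => bC2; have aC := subsetP TC _ aT; rewrite e_sym in eab.
    by have ar := isolated _ _ aC bC2 eab; rewrite -ar aT in rT.
  have [rS|] := boolP (r \in S); last exact: main.
  (* A part containing [r] is handled through its complement, which avoids [r]. *)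
  have [|||a [b [aT bT eab]]] := main ((C :\: C2) :\: S).
  - exact: subsetDl.
  - apply: contra SN => /eqP E; rewrite eqEsubset SC; apply/subsetP => w wC.
    by apply/negPn/negP => wS; have := in_set0 w; rewrite -E inE wS wC.
  - by rewrite !inE rS.
  exists b, a; rewrite e_sym eab aT; split => //.
  by move: bT; rewrite inE => /andP[+ bC]; rewrite inE bC andbT negbK.
- split.
  + by rewrite setUC -{1}(setIidPr C2subC) setID.
  + by rewrite disjoints_subset setDE subsetIr.
  + by rewrite inE rC2 rC.
Qed.

End Connected.

(** * Codimension of subspaces and energy of disjoint unions *)

Section Codim.
Context (R : realType) (V : finType).
Implicit Types (W : {vspace funs R V}) (q : nat).

Definition codim_le W q := (#|V| <= \dim W + q)%N.

Lemma codim_fullv : codim_le fullv 0.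
Proof. by rewrite /codim_le dim_funs addn0. Qed.

Lemma codim_cap W1 W2 q1 q2 : codim_le W1 q1 -> codim_le W2 q2 ->
  codim_le (W1 :&: W2) (q1 + q2).
Proof.
rewrite /codim_le; have := dimvS (subvf (W1 + W2)); rewrite dim_funs.
move: (dimv_sum_cap W1 W2).
move: (\dim (W1 + W2)) (\dim (W1 :&: W2)) (\dim W1) (\dim W2) #|V|; lia.
Qed.

Lemma ratio_subspace (s : R) (x y : V) :
  exists2 W, codim_le W 1 & forall u, u \in W -> u x = s * u y.
Proof.
pose F (u : funs R V) : R^o := u x - s * u y.
have linF : linear F.
  by move=> a u v; rewrite /F !ffunE /GRing.scale /= mulrDr; ring.
pose FL : {linear funs R V -> R^o} := HB.pack F (GRing.isLinear.Build _ _ _ _ F linF).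
exists (lker (linfun FL)).
  rewrite /codim_le -(dim_funs R V) -(limg_ker_dim (linfun FL) fullv) capfv.
  rewrite leq_add2l (leq_trans (dimvS (subvf _))) // dimvf.
  by rewrite /dim /=.
by move=> u; rewrite memv_ker lfunE /= /F subr_eq0 => /eqP.
Qed.

End Codim.

Section Energy.
Context (R : realType) (V : finType) (e : rel V).
Hypothesis e_sym : symmetric e.
Implicit Types (C D : {set V}) (u p : V -> R).
Local Notation energy := (energy e).

Definition cross C D u : R :=
  \sum_(x in C) \sum_(y in D) (e x y)%:R * (u x - u y) ^+ 2.

Lemma cross_term_ge0 u x y : 0 <= (e x y)%:R * (u x - u y) ^+ 2 :> R.
Proof. by rewrite mulr_ge0 ?sqr_ge0. Qed.

Lemma energy_ge0 C u : 0 <= energy C u.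
Proof.
rewrite mulr_ge0 ?invr_ge0 ?ler0n //; apply: sumr_ge0 => x _.
by apply: sumr_ge0 => y _; apply: cross_term_ge0.
Qed.

Lemma energy_setU C1 C2 u : [disjoint C1 & C2] ->
  energy (C1 :|: C2) u = energy C1 u + energy C2 u + cross C1 C2 u.
Proof.
move=> dis; have sumU (F : V -> R) :
    \sum_(x in C1 :|: C2) F x = \sum_(x in C1) F x + \sum_(x in C2) F x.
  by rewrite (eq_bigl _ _ (fun x => in_setU x C1 C2)) bigU.
have crossC : cross C2 C1 u = cross C1 C2 u.
  rewrite /cross exchange_big; apply: eq_bigr => x _; apply: eq_bigr => y _.
  by rewrite e_sym -sqrrN opprB.
rewrite /energy sumU; under eq_bigr do rewrite sumU.
under [X in _ + X]eq_bigr do rewrite sumU.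
rewrite !big_split /= -/(cross C1 C2 u) -/(cross C2 C1 u) crossC.
by field.
Qed.

Lemma cross_subset C1 C2 D1 D2 u : D1 \subset C1 -> D2 \subset C2 ->
  cross D1 D2 u <= cross C1 C2 u.
Proof.
move=> DC1 DC2; rewrite /cross [leRHS](big_setID D1) /= (setIidPr DC1).
rewrite ler_wpDr ?sumr_ge0 // => [x _|].
  by apply: sumr_ge0 => y _; apply: cross_term_ge0.
apply: ler_sum => x _; rewrite [leRHS](big_setID D2) /= (setIidPr DC2).
by rewrite ler_wpDr ?sumr_ge0 // => y _; apply: cross_term_ge0.
Qed.

Lemma cross_edge C1 C2 u x y : x \in C1 -> y \in C2 -> e x y ->
  (u y - u x) ^+ 2 <= cross C1 C2 u.
Proof.
move=> xC yC exy; apply: le_trans (cross_subset (D1 := [set x]) (D2 := [set y]) u _ _).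
- by rewrite /cross !big_set1 exy mul1r -sqrrN opprB.
- by rewrite sub1set.
- by rewrite sub1set.
Qed.

Lemma sqnorm_setU C1 C2 u : [disjoint C1 & C2] ->
  sqnorm (C1 :|: C2) u = sqnorm C1 u + sqnorm C2 u.
Proof.
by move=> dis; rewrite /sqnorm (eq_bigl _ _ (fun x => in_setU x C1 C2)) bigU.
Qed.

Lemma sum_indicator D x (c : R) : x \in D ->
  \sum_(y in D) c * (y == x)%:R = c.
Proof.
move=> xD; rewrite (bigD1 x) //= eqxx mulr1 big1 ?addr0 // => y /andP[_ /negbTE ->].
by rewrite mulr0.
Qed.

Lemma sum_indicator_sqr D p u x (c : R) : x \in D ->
  \sum_(y in D) (p y + c * (y == x)%:R) * u y ^+ 2 =
  \sum_(y in D) p y * u y ^+ 2 + c * u x ^+ 2.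
Proof.
move=> xD; under eq_bigr do rewrite mulrDl; rewrite big_split /=; congr (_ + _).
rewrite (bigD1 x) //= eqxx mulr1 big1 ?addr0 // => y /andP[_ /negbTE ->].
by rewrite mulr0 mul0r.
Qed.

End Energy.

(** * Cutting a graph into pieces of bounded size *)

Section Surgery.
Context (R : realType) (V : finType) (e : rel V).
Hypothesis e_sym : symmetric e.
Implicit Types (C D : {set V}) (u p : V -> R) (r : V) (q t : nat).
Local Notation energy := (energy e).
Local Notation connected := (connected e).

(** [K] bounds the size of a piece. The potentials [y] and the ratios [s] stay abstract so that one
    induction serves both claims: pinned vertices in the first, negative ratios in the second. *)
Variables (n K : nat) (b : R) (y s : nat -> R).
Hypothesis K_gt0 : (0 < K)%N.
Hypothesis b_ge0 : 0 <= b.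
Hypothesis bound1 : path_bound 1 K.-1 b.
Hypothesis y0 : y 0%N <= 0.
Hypothesis y_ge1 : forall m, (0 < m < n)%N -> 1 <= y m.
Hypothesis y_sub : forall a1 a2, (a1 + a2 < n)%N -> y (a1 + a2) <= y a1 + y a2.
(** The cut edge, with value [a] at its far end, pays twice: it completes the bound on the full
    piece [D] and leaves a potential [y q.+1] at the far end. *)
Hypothesis cut : forall q D p z u (a : R), (q.+1 < n)%N -> connected D ->
  #|D| = K -> (forall x, 0 <= p x) -> y q <= \sum_(x in D) p x ->
  z \in D -> u z = s q * a ->
  b * sqnorm D u + y q.+1 * a ^+ 2
    <= energy D u + \sum_(x in D) p x * u x ^+ 2 + (u z - a) ^+ 2.

(* With r the root of C: C is settled when q linear conditions force u r = 0 and
   the bound on C; otherwise a residual piece D containing r is still waiting for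
   its bound, and p is the potential that the edges cut so far exert on it.  Each
   condition accounts for at least K vertices, t counts the surplus, and y q is
   the potential guaranteed after q cuts without surplus. *)
Definition settled C r q t : Prop := [/\ (0 < t)%N, #|C| = (q * K + t)%N &
  exists2 W : {vspace funs R V}, codim_le W q &
    forall u : funs R V, u \in W -> u r = 0 /\ b * sqnorm C u <= energy C u].

Definition residual C D p q t : Prop :=
  [/\ D \subset C, connected D, (#|D| <= K)%N & #|C| = (q * K + #|D| + t)%N] /\
  [/\ forall x, 0 <= p x,
    (if t == 0%N then y q else 1) <= \sum_(x in D) p x &
  exists2 W : {vspace funs R V}, codim_le W q &
    forall u : funs R V, u \in W -> b * (sqnorm C u - sqnorm D u) + energy D u
      + \sum_(x in D) p x * u x ^+ 2 <= energy C u].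

Definition pending C r q t : Prop := exists D p, r \in D /\ residual C D p q t.

(** The term at [z] is what an edge to a zero of the function contributes. With fewer than [K]
    vertices [bound1] then applies, so no condition is spent. *)
Lemma small_bound D z u : connected D -> z \in D -> (#|D| < K)%N ->
  b * sqnorm D u <= energy D u + u z ^+ 2.
Proof.
move=> connD zD D_lt; have D_gt0 : (0 < #|D|)%N by rewrite card_gt0; apply/set0Pn; exists z.
have -> : u z ^+ 2 = \sum_(x in D) (0 + 1 * (x == z)%:R) * u x ^+ 2.
  rewrite (sum_indicator_sqr (fun=> 0)) // big1 => [|x _]; last by rewrite mul0r.
  by rewrite add0r mul1r.
apply: (connected_bound e_sym u b_ge0 bound1 connD) => [|x _|]; first by lia.
  by rewrite add0r mul1r ler0n.
by rewrite big_split /= big1 ?add0r // sum_indicator.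
Qed.

Lemma zero_bound D z u : connected D -> z \in D -> (#|D| <= K)%N -> u z = 0 ->
  b * sqnorm D u <= energy D u.
Proof. by move=> connD zD D_le uz; apply: (connected_bound0 e_sym b_ge0 bound1 connD D_le zD). Qed.

(** * Merging two branches along the edge from [r] to [z] *)

Section Merge.
Variables (C1 C2 : {set V}) (r z : V).
Hypothesis dis : [disjoint C1 & C2].
Hypothesis rC1 : r \in C1.
Hypothesis zC2 : z \in C2.
Hypothesis erz : e r z.
Hypothesis C_le : (#|C1 :|: C2| <= n * K)%N.
Variables (q1 t1 q2 t2 : nat).
Local Notation C := (C1 :|: C2).

Let cardC : #|C| = (#|C1| + #|C2|)%N.
Proof. by apply/eqP; rewrite leq_card_setU.  Qed.

Let edge u : (u z - u r) ^+ 2 <= cross e C1 C2 u.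
Proof. exact: cross_edge. Qed.

Lemma merge_settled_settled : settled C1 r q1 t1 -> settled C2 z q2 t2 ->
  settled C r (q1 + q2) (t1 + t2).
Proof.
move=> [t1_gt0 card1 [W1 dimW1 hW1]] [t2_gt0 card2 [W2 dimW2 hW2]].
split; [by rewrite !addn_gt0 t1_gt0 | rewrite cardC card1 card2; clear; lia |
  exists (W1 :&: W2)%VS].
  exact: codim_cap.
move=> u; rewrite memv_cap => /andP[/hW1[ur h1] /hW2[uz h2]]; split => //.
rewrite energy_setU // sqnorm_setU //; have := edge u; rewrite ur uz subr0 expr0n /=.
lra.
Qed.

(** The [K] vertices of the full piece pay for the condition [u z = 0]. *)
Lemma merge_settled_full D p : settled C1 r q1 t1 -> residual C2 D p q2 t2 ->
  z \in D -> #|D| = K -> settled C r (q1 + q2 + 1) (t1 + t2).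
Proof.
move=> [t1_gt0 card1 [W1 dimW1 hW1]] [[_ connD _ card2] [p_ge0 _ [W2 dimW2 hW2]]] zD cD.
have [W3 dimW3 hW3] := ratio_subspace (0 : R) z z.
split; [by rewrite addn_gt0 t1_gt0 | rewrite cardC card1 card2 cD; clear; lia |
  exists (W1 :&: W2 :&: W3)%VS].
  by do 2?apply: codim_cap.
move=> u; rewrite !memv_cap => /andP[/andP[/hW1[ur h1] /hW2 h2] /hW3]; rewrite mul0r => uz.
split => //; rewrite energy_setU // sqnorm_setU //.
have := edge u; have := sqr_ge0 (u z - u r).
have : b * sqnorm D u <= energy D u by apply: zero_bound uz; rewrite ?cD.
have : 0 <= \sum_(x in D) p x * u x ^+ 2.
  by apply: sumr_ge0 => x _; rewrite mulr_ge0 ?sqr_ge0.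
lra.
Qed.

(** Since [u r = 0], the joining edge is a unit potential on [D], whose vertices all become
    surplus. *)
Lemma merge_settled_small D p : settled C1 r q1 t1 -> residual C2 D p q2 t2 ->
  z \in D -> (#|D| < K)%N -> settled C r (q1 + q2) (t1 + t2 + #|D|).
Proof.
move=> [t1_gt0 card1 [W1 dimW1 hW1]] [[_ connD _ card2] [p_ge0 _ [W2 dimW2 hW2]]] zD cD.
split; [by rewrite !addn_gt0 t1_gt0 | rewrite cardC card1 card2; clear; lia |
  exists (W1 :&: W2)%VS].
  exact: codim_cap.
move=> u; rewrite !memv_cap => /andP[/hW1[ur h1] /hW2 h2].
split => //; rewrite energy_setU // sqnorm_setU //.
have := edge u; rewrite ur subr0.
have := small_bound u connD zD cD.
have : 0 <= \sum_(x in D) p x * u x ^+ 2.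
  by apply: sumr_ge0 => x _; rewrite mulr_ge0 ?sqr_ge0.
lra.
Qed.

(** Since [u z = 0], the joining edge becomes a unit potential at [r], which is enough because [t2]
    is positive. *)
Lemma merge_residual_settled D p : residual C1 D p q1 t1 -> r \in D ->
  settled C2 z q2 t2 -> pending C r (q1 + q2) (t1 + t2).
Proof.
move=> [[DC connD cD card1] [p_ge0 sump [W1 dimW1 hW1]]] rD.
move=> [t2_gt0 card2 [W2 dimW2 hW2]].
exists D, (fun x => p x + 1 * (x == r)%:R); split => //; split.
  split => //; first exact: subset_trans DC (subsetUl _ _).
  by rewrite cardC card1 card2; clear; lia.
split.
- by move=> x; rewrite mul1r addr_ge0.
- rewrite ifF; last by rewrite addn_eq0 (gtn_eqF t2_gt0) andbF.
  by rewrite big_split /= sum_indicator // lerDr sumr_ge0.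
exists (W1 :&: W2)%VS; first exact: codim_cap.
move=> u; rewrite memv_cap => /andP[/hW1 h1 /hW2[uz h2]].
rewrite sum_indicator_sqr // energy_setU // sqnorm_setU //.
have := edge u; rewrite uz sub0r sqrrN; lra.
Qed.

(** One condition cuts off [D2]. Without surplus it is the ratio [s q2], and [r] receives the
    potential [y q2.+1], combined with the earlier one by [y_sub]; with surplus it is [u z = 0], and
    [r] receives 1. *)
Lemma merge_residual_full D1 p1 D2 p2 : residual C1 D1 p1 q1 t1 -> r \in D1 ->
  residual C2 D2 p2 q2 t2 -> z \in D2 -> #|D2| = K ->
  pending C r (q1 + (q2 + 1)) (t1 + t2).
Proof.
move=> [[DC1 connD1 cD1 card1] [p1_ge0 sump1 [W1 dimW1 hW1]]] rD1.
move=> [[DC2 connD2 _ card2] [p2_ge0 sump2 [W2 dimW2 hW2]]] zD2 cD2.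
have D1_gt0 : (0 < #|D1|)%N by rewrite card_gt0; apply/set0Pn; exists r.
have q_lt : (q1 + q2.+1 < n)%N.
  have : ((q1 + q2.+1) * K < n * K)%N.
    by move: C_le D1_gt0; rewrite cardC card1 card2 cD2; clear; lia.
  by rewrite ltn_mul2r => /andP[].
pose tight := (t1 + t2 == 0)%N; pose c := if tight then y q2.+1 else 1.
have c_ge1 : 1 <= c by rewrite /c; case: ifP => // _; apply: y_ge1; move: q_lt; clear; lia.
have [W3 dimW3 hW3] := ratio_subspace (if tight then s q2 else 0 : R) z r.
exists D1, (fun x => p1 x + c * (x == r)%:R); split => //; split.
  split => //; first exact: subset_trans DC1 (subsetUl _ _).
  by rewrite cardC card1 card2 cD2; clear; lia.
split.
- by move=> x; rewrite addr_ge0 // mulr_ge0 ?ler0n // (le_trans ler01).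
- rewrite big_split /= sum_indicator // -/tight /c; case: ifP => [|_].
    rewrite /tight addn_eq0 => /andP[/eqP t10 _]; rewrite t10 eqxx in sump1.
    by rewrite addn1 (le_trans (y_sub q_lt)) // lerD2r.
  by rewrite lerDr sumr_ge0.
exists (W1 :&: (W2 :&: W3))%VS; first by do 2?apply: codim_cap.
move=> u; rewrite !memv_cap => /and3P[/hW1 h1 /hW2 h2 /hW3 uz].
rewrite sum_indicator_sqr // energy_setU // sqnorm_setU //.
suff : b * sqnorm D2 u + c * u r ^+ 2 <=
    energy D2 u + \sum_(x in D2) p2 x * u x ^+ 2 + (u z - u r) ^+ 2.
  have := edge u; lra.
move: uz; rewrite /c; case: ifP => [|_ uz].
  rewrite /tight addn_eq0 => /andP[_ /eqP t20] uz; rewrite t20 eqxx in sump2.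
  by apply: cut uz => //; apply: leq_ltn_trans q_lt; apply: leq_addl.
rewrite mul0r in uz.
have : b * sqnorm D2 u <= energy D2 u by apply: zero_bound uz; rewrite ?cD2.
have : 0 <= \sum_(x in D2) p2 x * u x ^+ 2.
  by apply: sumr_ge0 => x _; rewrite mulr_ge0 ?sqr_ge0.
rewrite uz sub0r sqrrN; lra.
Qed.

(** Nothing is cut and the potentials add up. Without surplus [y_sub] applies; otherwise a branch
    with surplus already carries total potential 1. *)
Lemma merge_residual_small D1 p1 D2 p2 : residual C1 D1 p1 q1 t1 -> r \in D1 ->
  residual C2 D2 p2 q2 t2 -> z \in D2 -> (#|D1| + #|D2| <= K)%N ->
  pending C r (q1 + q2) (t1 + t2).
Proof.
move=> [[DC1 connD1 cD1 card1] [p1_ge0 sump1 [W1 dimW1 hW1]]] rD1.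
move=> [[DC2 connD2 cD2 card2] [p2_ge0 sump2 [W2 dimW2 hW2]]] zD2 cD.
have D1_gt0 : (0 < #|D1|)%N by rewrite card_gt0; apply/set0Pn; exists r.
have q_lt : (q1 + q2 < n)%N.
  have : ((q1 + q2) * K < n * K)%N by move: C_le D1_gt0; rewrite cardC card1 card2; clear; lia.
  by rewrite ltn_mul2r => /andP[].
have disD : [disjoint D1 & D2].
  by apply: disjointWl DC1 _; apply: disjointWr DC2 _.
pose p x := if x \in D1 then p1 x else p2 x.
have sumU (F1 F2 : V -> R) : \sum_(x in D1 :|: D2) (if x \in D1 then F1 x else F2 x) =
    \sum_(x in D1) F1 x + \sum_(x in D2) F2 x.
  rewrite (eq_bigl _ _ (fun x => in_setU x D1 D2)) bigU //=; congr (_ + _).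
    by apply: eq_bigr => x ->.
  by apply: eq_bigr => x xD2; rewrite (disjointFl disD xD2).
have cardD : #|D1 :|: D2| = (#|D1| + #|D2|)%N.
  by apply/eqP; rewrite leq_card_setU.
have s1_ge0 : 0 <= \sum_(x in D1) p1 x by apply: sumr_ge0.
have s2_ge0 : 0 <= \sum_(x in D2) p2 x by apply: sumr_ge0.
exists (D1 :|: D2), p; split; first by rewrite inE rD1.
split.
  split; first exact: setUSS.
  - exact: (connected_setU e_sym connD1 connD2 rD1 zD2 erz).
  - by rewrite cardD.
  - by rewrite cardC card1 card2 cardD; clear; lia.
split.
- by move=> x; rewrite /p; case: ifP.
- rewrite sumU; have := y_sub q_lt; move: sump1 sump2.
  by case: (t1) => [|t1']; case: (t2) => [|t2'] //=; lra.
exists (W1 :&: W2)%VS; first exact: codim_cap.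
move=> u; rewrite !memv_cap => /andP[/hW1 h1 /hW2 h2].
rewrite (eq_bigr (fun x => if x \in D1 then p1 x * u x ^+ 2 else p2 x * u x ^+ 2)); last first.
  by move=> x _; rewrite /p; case: ifP.
rewrite sumU !energy_setU // !sqnorm_setU //.
have := cross_subset e u DC1 DC2; lra.
Qed.

(** The single condition [u r = 0] settles both pieces: [D1] contains a zero, and the joining edge
    is a unit potential on [D2]. The vertices beyond [K] are surplus. *)
Lemma merge_residual_large D1 p1 D2 p2 : residual C1 D1 p1 q1 t1 -> r \in D1 ->
  residual C2 D2 p2 q2 t2 -> z \in D2 -> (#|D2| < K)%N -> (K < #|D1| + #|D2|)%N ->
  settled C r (q1 + q2 + 1) (t1 + t2 + (#|D1| + #|D2| - K)).
Proof.
move=> [[DC1 connD1 cD1 card1] [p1_ge0 sump1 [W1 dimW1 hW1]]] rD1.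
move=> [[DC2 connD2 cD2 card2] [p2_ge0 sump2 [W2 dimW2 hW2]]] zD2 D2_lt cD.
have [W3 dimW3 hW3] := ratio_subspace (0 : R) r r.
split; [by rewrite addn_gt0 subn_gt0 cD orbT | | exists (W1 :&: W2 :&: W3)%VS].
  by rewrite cardC card1 card2; move: cD; clear; lia.
  by do 2?apply: codim_cap.
move=> u; rewrite !memv_cap => /andP[/andP[/hW1 h1 /hW2 h2] /hW3]; rewrite mul0r => ur.
split => //; rewrite energy_setU // sqnorm_setU //.
have := edge u; rewrite ur subr0.
have := small_bound u connD2 zD2 D2_lt.
have := zero_bound connD1 rD1 cD1 ur.
have : 0 <= \sum_(x in D1) p1 x * u x ^+ 2.
  by apply: sumr_ge0 => x _; rewrite mulr_ge0 ?sqr_ge0.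
have : 0 <= \sum_(x in D2) p2 x * u x ^+ 2.
  by apply: sumr_ge0 => x _; rewrite mulr_ge0 ?sqr_ge0.
lra.
Qed.

End Merge.

Lemma settled_or_pending C r : connected C -> r \in C -> (#|C| <= n * K)%N ->
  exists q t, settled C r q t \/ pending C r q t.
Proof.
have [N] := ubnP #|C|; elim: N => // N IH in C r *; rewrite ltnS => C_leN connC rC C_le.
have [->|Cr] := eqVneq C [set r].
  (* A single vertex is its own residual piece without potential, as [y 0 <= 0] permits. *)
  exists 0%N, 0%N; right; exists [set r], (fun=> 0); rewrite set11; split => //; split.
    by split=> //; [exact: connected1 | rewrite cards1 | rewrite cards1].
  split => //; first by rewrite eqxx big1.
  exists fullv; first exact: codim_fullv.
  by move=> u _; rewrite subrr mulr0 add0r big1 ?addr0 // => x _; rewrite mul0r.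
have [C1 [C2 [z [[CE dis rC1] zC2 erz conn1 conn2]]]] := connected_split e_sym connC rC Cr.
have cardC : #|C| = (#|C1| + #|C2|)%N.
  by apply/eqP; rewrite CE leq_card_setU.
have C1_gt0 : (0 < #|C1|)%N by rewrite card_gt0; apply/set0Pn; exists r.
have C2_gt0 : (0 < #|C2|)%N by rewrite card_gt0; apply/set0Pn; exists z.
have [||q1 [t1 st1]] := IH C1 r _ conn1 rC1; [by move: cardC C_leN C_le C2_gt0; clear; lia..|].
have [||q2 [t2 st2]] := IH C2 z _ conn2 zC2; [by move: cardC C_leN C_le C1_gt0; clear; lia..|].
rewrite {}CE in C_le *.
case: st1 => [cl1|[D1 [p1 [rD1 res1]]]]; case: st2 => [cl2|[D2 [p2 [zD2 res2]]]].
- by exists (q1 + q2)%N, (t1 + t2)%N; left; apply: (@merge_settled_settled _ _ r z).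
- have [D2_lt|D2_ge] := ltnP #|D2| K.
    by do 2eexists; left; apply: (@merge_settled_small _ _ r z); eassumption.
  have cD2 : #|D2| = K by apply/eqP; rewrite eqn_leq D2_ge andbT; case: res2 => -[].
  by do 2eexists; left; apply: (@merge_settled_full _ _ r z); eassumption.
- by do 2eexists; right; apply: (@merge_residual_settled _ _ r z); eassumption.
- have [D_le|D_gt] := leqP (#|D1| + #|D2|) K.
    by do 2eexists; right; apply: (@merge_residual_small _ _ r z); eassumption.
  have [D2_lt|D2_ge] := ltnP #|D2| K.
    by do 2eexists; left; apply: (@merge_residual_large _ _ r z); eassumption.
  have cD2 : #|D2| = K by apply/eqP; rewrite eqn_leq D2_ge andbT; case: res2 => -[].
  by do 2eexists; right; apply: (@merge_residual_full _ _ r z); eassumption.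
Qed.

(** Counting vertices gives [q < n]. In the pending case, a condition that is left over pins [u r].
    If none is left, either [D] is small and its potential is at least 1, or it is full, there is no
    surplus and [tight] applies. *)
Lemma bound_subspace C : connected C -> C != set0 -> (2 <= n)%N -> (#|C| <= n * K)%N ->
  (#|C| = (n * K)%N -> forall D p u, connected D -> #|D| = K -> (forall x, 0 <= p x) ->
    y n.-1 <= \sum_(x in D) p x ->
    b * sqnorm D u <= energy D u + \sum_(x in D) p x * u x ^+ 2) ->
  exists2 W : {vspace funs R V}, codim_le W n.-1 &
    forall u : funs R V, u \in W -> b * sqnorm C u <= energy C u.
Proof.
move=> connC /set0Pn[r rC] n_ge2 C_le tight.
have weaken (W : {vspace funs R V}) q : (q < n)%N -> codim_le W q -> codim_le W n.-1.
  by rewrite /codim_le; lia.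
have [q [t []]] := settled_or_pending connC rC C_le.
  case=> t_gt0 cardC [W dimW hW]; exists W; last by move=> u /hW[].
  apply: weaken dimW; have : (q * K < n * K)%N by move: C_le t_gt0; rewrite cardC; clear; lia.
  by rewrite ltn_mul2r => /andP[].
case=> D [p [rD [[_ connD cD cardC] [p_ge0 sump [W dimW hW]]]]].
have D_gt0 : (0 < #|D|)%N by rewrite card_gt0; apply/set0Pn; exists r.
have q_lt : (q < n)%N.
  have : (q * K < n * K)%N by move: C_le D_gt0; rewrite cardC; clear; lia.
  by rewrite ltn_mul2r => /andP[].
have [q_small|q_large] := ltnP q.+1 n.
  have [W' dimW' hW'] := ratio_subspace (0 : R) r r.
  exists (W :&: W')%VS; first by apply: weaken q_small _; rewrite -addn1; apply: codim_cap.
  move=> u; rewrite memv_cap => /andP[/hW h /hW']; rewrite mul0r => ur.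
  have := zero_bound connD rD cD ur.
  have : 0 <= \sum_(x in D) p x * u x ^+ 2.
    by apply: sumr_ge0 => x _; rewrite mulr_ge0 ?sqr_ge0.
  lra.
have qE : q = n.-1 by move: q_lt q_large; clear; lia.
exists W; first exact: weaken dimW.
move=> u /hW h.
suff : b * sqnorm D u <= energy D u + \sum_(x in D) p x * u x ^+ 2 by lra.
have [D_lt|D_ge] := ltnP #|D| K.
  apply: (connected_bound e_sym u b_ge0 bound1 connD) => //; first lia.
  by apply: le_trans sump; case: ifP => // _; apply: y_ge1; lia.
have nK : (n * K = n.-1 * K + K)%N by rewrite -mulSnr prednK // (leq_trans _ n_ge2).
have t0 : t = 0%N by move: C_le D_ge; rewrite cardC qE nK; clear; lia.
rewrite t0 /= qE in sump.
apply: tight => //; move: cD D_ge; last by clear; lia.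
by rewrite cardC qE t0 nK; clear; lia.
Qed.

End Surgery.

(** * Explicit bounds on paths *)

(** [phi l.+1] belongs to [v l]. Comparison with the positive solution [phi] bounds the energy minus
    [b] times the norm from below by a sum of squares plus an end term, which vanishes at [k] by
    [phi_end]. *)
Lemma path_bound_supersolution (R : realType) (k : nat) (phi : nat -> R) (c : R) :
  (0 < k)%N -> (forall l, phi l.+2 = 2 * c * phi l.+1 - phi l) ->
  (forall l, (0 < l <= k)%N -> 0 < phi l) -> phi 0%N = 0 -> phi k.+1 = phi k ->
  path_bound 1 k (2 * (1 - c)).
Proof.
move=> k_gt0 phi_rec phi_gt0 phi0 phi_end v; set b := 2 * _.
have partial m : (0 < m <= k)%N ->
    (phi m.+1 / phi m - 1) * v m.-1 ^+ 2
      <= path_energy 1 m v - b * \sum_(0 <= l < m) v l ^+ 2.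
  elim: m => // -[_ _|m IH m_le].
    rewrite /path_energy /= big_geq // big_nat1 phi_rec phi0 subr0.
    rewrite mulfK; last by rewrite gt_eqF // phi_gt0.
    by rewrite /b; lra.
  rewrite /path_energy /= (big_nat_recr m) //= (big_nat_recr m.+1) //=.
  have {IH} := IH ltac:(lia); rewrite /path_energy /=.
  set s1 := \sum_(_ <= _ < _) _; set s2 := \sum_(_ <= _ < _) _.
  have p1 : 0 < phi m.+1 by rewrite phi_gt0; lia.
  have p2 : 0 < phi m.+2 by rewrite phi_gt0; lia.
  have -> : phi m.+3 / phi m.+2 = 2 * c - phi m.+1 / phi m.+2.
    by rewrite phi_rec mulrBl mulfK // gt_eqF.
  set rho := phi m.+2 / phi m.+1.
  have -> : phi m.+1 / phi m.+2 = rho^-1 by rewrite invf_div.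
  have rho_gt0 : 0 < rho by rewrite divr_gt0.
  have : 0 <= rho * (v m - rho^-1 * v m.+1) ^+ 2.
    by rewrite mulr_ge0 ?sqr_ge0 // ltW.
  have -> : rho * (v m - rho^-1 * v m.+1) ^+ 2 =
      rho * v m ^+ 2 - 2 * v m * v m.+1 + rho^-1 * v m.+1 ^+ 2.
    move: (rho) (v m) (v m.+1) rho_gt0 => r x y r0.
    by field; rewrite gt_eqF.
  rewrite /b; move: (rho) (rho^-1) (v m) (v m.+1) s1 s2 (v 0%N) => *; lra.
have := partial k; rewrite k_gt0 leqnn => /(_ isT).
by rewrite phi_end divff ?subrr ?mul0r ?subr_ge0 // gt_eqF // phi_gt0 // k_gt0 leqnn.
Qed.

Lemma sin_progression (R : realType) (a t : R) (l : nat) :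
  sin (l.+2%:R * t + a) = 2 * cos t * sin (l.+1%:R * t + a) - sin (l%:R * t + a).
Proof.
set x := l.+1%:R * t + a.
have -> : l.+2%:R * t + a = x + t by rewrite /x; ring.
have -> : l%:R * t + a = x - t by rewrite /x; ring.
by rewrite sinD sinB; ring.
Qed.

Lemma sin_pi_sub (R : realType) (x : R) : sin (pi - x) = sin x.
Proof. by rewrite sinB sinpi cospi mul0r mulN1r opprK add0r. Qed.

(** The solution [sin (l t)] agrees at [k] and [k.+1], since the two arguments add up to [pi]. *)
Lemma path_bound_dirichlet (R : realType) (k : nat) : (0 < k)%N ->
  path_bound 1 k (2 * (1 - cos (pi / (2 * k + 1)%:R)) : R).
Proof.
move=> k_gt0; set t : R := pi / _.
have den_gt0 : 0 < (2 * k + 1)%:R :> R by rewrite ltr0n addn1.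
have t_gt0 : 0 < t by rewrite divr_gt0 ?pi_gt0.
have tE : (2 * k + 1)%:R * t = pi by rewrite /t mulrC divfK // gt_eqF.
apply: (@path_bound_supersolution _ _ (fun l => sin (l%:R * t + 0))) => //.
- by move=> l; apply: sin_progression.
- move=> l /andP[l_gt0 l_le]; apply: sin_gt0_pi.
  rewrite addr0 mulr_gt0 ?ltr0n //= -tE ltr_pM2r // ltr_nat.
  by move: l_le; clear; lia.
- by rewrite mul0r addr0 sin0.
- rewrite !addr0 -[RHS]sin_pi_sub -tE; congr sin.
  by rewrite -mulrBl -natrB; [congr (_%:R * _) |]; clear; lia.
Qed.

(** * Potentials passed on through cut edges *)

Section Spring.
Context (R : realType) (n : nat).
Hypothesis n_ge2 : (2 <= n)%N.

(* Up to sign, half_sine m.+1 is the m-th entry of the top eigenvector of the path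
   on n vertices, and path_top its eigenvalue.  spring m is the potential exerted
   through a cut edge by a chain of m pieces; an edge cut with ratio - s splits
   its energy with the weights 1 + s^-1 and 1 + s. *)
Definition half_sine (m : nat) : R := sin (m%:R * (pi / n%:R) + - (pi / n%:R) / 2).

Definition spring (m : nat) : R := 1 + half_sine m / half_sine m.+1.

Definition path_top : R := 2 + 2 * cos (pi / n%:R).

Let t : R := pi / n%:R.

Let t_gt0 : 0 < t. Proof. by rewrite divr_gt0 ?pi_gt0 // ltr0n; lia. Qed.

Let tE : n%:R * t = pi.
Proof. by rewrite /t mulrC divfK // pnatr_eq0; lia. Qed.

Lemma half_sine_rec l :
  half_sine l.+2 = 2 * cos (pi / n%:R) * half_sine l.+1 - half_sine l.
Proof. exact: sin_progression. Qed.

Lemma half_sine_gt0 m : (0 < m <= n)%N -> 0 < half_sine m.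
Proof.
move=> /andP[m_gt0 m_le]; apply: sin_gt0_pi; rewrite -/t -tE.
have h1 : t <= m%:R * t by rewrite ler_peMl ?(ltW t_gt0) // ler1n.
have h2 : m%:R * t <= n%:R * t by rewrite ler_pM2r // ler_nat.
move: t_gt0 h1 h2; move: (m%:R * t) (n%:R * t) (t) => *.
by apply/andP; split; lra.
Qed.

Lemma spring0 : spring 0 = 0.
Proof.
rewrite /spring; have -> : half_sine 0 = - half_sine 1.
  by rewrite /half_sine -/t -sinN; congr sin; field.
by rewrite mulNr divff ?subrr // gt_eqF // half_sine_gt0 //; lia.
Qed.

Lemma spring_ge1 m : (0 < m < n)%N -> 1 <= spring m.
Proof.
by move=> /andP[m_gt0 m_lt]; rewrite lerDl divr_ge0 // ltW // half_sine_gt0; lia.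
Qed.

(** What a piece under potential [spring m] lacks to reach [path_top] is the share [1 + s^-1] of the
    next cut edge, for [s = half_sine m.+1 / half_sine m.+2]. *)
Lemma spring_dual m : (m < n)%N ->
  path_top - spring m = 1 + half_sine m.+2 / half_sine m.+1.
Proof.
move=> m_lt; rewrite half_sine_rec mulrBl mulfK.
  by rewrite /spring /path_top; ring.
by rewrite gt_eqF // half_sine_gt0 //; lia.
Qed.

(** [half_sine] is odd about [n + 1/2], so after [n.-1] cuts nothing is lacking. *)
Lemma spring_last : spring n.-1 = path_top.
Proof.
have := @spring_dual n.-1; have -> : n.-1.+1 = n by lia.
move=> /(_ ltac:(lia)).
have nE : half_sine n = sin (t / 2).
  by rewrite /half_sine -/t tE mulNr sin_pi_sub.
have -> : half_sine n.+1 = - half_sine n.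
  rewrite nE -sinN -[RHS]sin_pi_sub /half_sine -/t; congr sin.
  by rewrite -(addn1 n) natrD mulrDl tE; field.
rewrite mulNr divff ?subrr => [/eqP|]; first by rewrite subr_eq0 => /eqP ->.
by rewrite gt_eqF // half_sine_gt0 //; lia.
Qed.

Lemma sin_shift (p q a : R) :
  sin (p + q + a) * sin p = sin (p + a) * sin (p + q) - sin a * sin q.
Proof.
have := cos2Dsin2 p; rewrite !(sinD, cosD).
move: (sin p) (cos p) (sin q) (cos q) (sin a) (cos a) => sp cp sq cq sa ca h.
have : sa * sq * (cp ^+ 2 + sp ^+ 2) = sa * sq by rewrite h mulr1.
by lra.
Qed.

(* With p = a t, q = b t and h = t / 2, clearing denominators leaves
   0 <= sin p * sin q * sin (p + q + 2 h). *)
Lemma spring_sub a b : (a + b < n)%N -> spring (a + b) <= spring a + spring b.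
Proof.
move=> ab_lt; pose h := t / 2; pose p := a%:R * t; pose q := b%:R * t.
have hE m : half_sine m.+1 = sin (m%:R * t + h).
  by rewrite /half_sine -/t; congr sin; rewrite /h -natr1; field.
have sE m : half_sine m.+1 + half_sine m = 2 * cos h * sin (m%:R * t).
  rewrite hE /half_sine -/t mulNr -/h sinD sinB; ring.
have cos_ge0 : 0 <= cos h.
  apply: cos_ge0_pihalf; have pi0 := pi_gt0 R; rewrite /h /t; apply/andP; split.
    by apply: (@le_trans _ _ 0); [rewrite oppr_le0 | rewrite !divr_ge0 // ltW]; lra.
  by rewrite ler_pM2r ?invr_gt0 // ler_pdivrMr ?ltr0n ?ler_peMr ?ler1n // ?ltW //; lia.
have pos m : (m < n)%N -> 0 < half_sine m.+1 by move=> ?; rewrite half_sine_gt0.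
have springE m : (m < n)%N -> spring m = 2 * cos h * sin (m%:R * t) / half_sine m.+1.
  by move=> m_lt; rewrite -sE mulrDl divff // gt_eqF // pos.
rewrite !springE //; [|lia..].
have a_gt0 := pos a ltac:(lia); have b_gt0 := pos b ltac:(lia).
have ab_gt0 := pos _ ab_lt.
rewrite -!mulrA -2!mulrDr ler_pM2l // ler_wpM2l //.
rewrite addf_div ?gt_eqF // ler_pdivrMr // mulrAC ler_pdivlMr ?mulr_gt0 //.
have sin_ge0 m : (m <= n)%N -> 0 <= sin (m%:R * t).
  move=> m_le; apply: sin_ge0_pi.
  by rewrite mulr_ge0 ?ler0n ?(ltW t_gt0) //= -tE ler_pM2r // ler_nat.
have := sin_shift p q h; have := sin_shift p (q + h) h.
have -> : p + (q + h) + h = (a + b).+1%:R * t.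
  by rewrite /p /q /h -(addn1 (a + b)) !natrD; field.
have -> : p + (q + h) = (a + b)%:R * t + h by rewrite natrD /p /q; ring.
have -> : p + q = (a + b)%:R * t by rewrite natrD /p /q; ring.
rewrite /p /q -!hE.
have : 0 <= sin (b%:R * t) * (sin ((a + b).+1%:R * t) * sin (a%:R * t)).
  by rewrite !mulr_ge0 // sin_ge0 //; lia.
(* With these factors the two instances of [sin_shift] cancel their terms in [sin h]. *)
move=> h0 h1 h2; have := congr1 ( *%R (half_sine b.+1)) h2.
have := congr1 ( *%R (sin (b%:R * t))) h1; lra.
Qed.

(** Completing squares along the alternating top eigenvector. For [m = n.-1], where [spring m] is
    [path_top], this bounds the energy of the whole path by [path_top] times the norm. *)
Lemma spring_energy (v : nat -> R) m : (m < n)%N ->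
  \sum_(0 <= l < m) (v l.+1 - v l) ^+ 2 <=
  path_top * (\sum_(0 <= l < m) v l ^+ 2) + spring m * v m ^+ 2.
Proof.
elim: m => [|m IH] m_lt; first by rewrite !big_geq // mulr0 spring0 mul0r addr0.
have {}IH := IH (ltnW m_lt); rewrite !big_nat_recr //=.
set s1 := \sum_(_ <= _ < _) _ in IH *; set s2 := \sum_(_ <= _ < _) _ in IH *.
have p1 : 0 < half_sine m.+1 by rewrite half_sine_gt0 //; lia.
have p2 : 0 < half_sine m.+2 by rewrite half_sine_gt0 //; lia.
have := spring_dual (ltnW m_lt); rewrite {2}/spring.
set rho := half_sine m.+2 / half_sine m.+1.
have -> : half_sine m.+1 / half_sine m.+2 = rho^-1 by rewrite invf_div.
have rho_gt0 : 0 < rho by rewrite divr_gt0.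
have : 0 <= rho * (v m + rho^-1 * v m.+1) ^+ 2.
  by rewrite mulr_ge0 ?sqr_ge0 // ltW.
have -> : rho * (v m + rho^-1 * v m.+1) ^+ 2 =
    rho * v m ^+ 2 + 2 * v m * v m.+1 + rho^-1 * v m.+1 ^+ 2.
  move: (rho) (v m) (v m.+1) rho_gt0 => r x y r0.
  by field; rewrite gt_eqF.
move: (rho) (rho^-1) (v m) (v m.+1) s1 s2 (path_top) (spring m) IH => r r' x y s1 s2 T S.
move=> IH h E; have -> : T = 1 + r + S by rewrite -E; ring.
move: IH; have -> : T = 1 + r + S by rewrite -E; ring.
lra.
Qed.

End Spring.

(** * Laplacians in block form and the Schur complement *)

Lemma linear_linfunE (R : realType) (aT rT : vectType R) (f : aT -> rT) u :
  linear f -> linfun f u = f u.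
Proof.
move=> lin_f.
pose F : {linear aT -> rT} := HB.pack f (GRing.isLinear.Build _ _ _ _ f lin_f).
exact: (lfunE F u).
Qed.

Section Operators.
Context (R : realType) (V : finType).
Variable w : V -> V -> R.
Hypothesis w_sym : forall x y, w x y = w y x.
Implicit Types (A B : {set V}).
Local Notation L := (lap_fun (unit_measure R V) w).
Local Notation m1 := (unit_measure R V).

Lemma lap_fun_linear : linear L.
Proof.
move=> a u v; apply/ffunP => x; rewrite !ffunE invr1 !mul1r.
rewrite [X in _ = X + _]mulr_sumr -big_split; apply: eq_bigr => y _.
by rewrite !ffunE /GRing.scale /=; ring.
Qed.

Lemma ext0_val A (u : funs R (subV A)) (x : subV A) : ext0 u (val x) = u x.
Proof. by rewrite ffunE valK. Qed.

Lemma ext0_out A (u : funs R (subV A)) x : x \notin A -> ext0 u x = 0.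
Proof. by move=> xA; rewrite ffunE insubF //; apply/negbTE. Qed.

Lemma ext0_linear A : linear (@ext0 R V A).
Proof.
move=> a u v; apply/ffunP => x; rewrite !ffunE.
by case: insub => [y|] /=; rewrite ?ffunE // [_ *: _]mulr0 addr0.
Qed.

Lemma restr_linear A : linear (@restr R V A).
Proof. by move=> a u v; apply/ffunP => x; rewrite !ffunE. Qed.

Lemma dot_restr A u (v : funs R (subV A)) : dot (restr A u) v = dot u (ext0 v).
Proof.
rewrite /dot [RHS](bigID (mem A)) /= [X in _ + X]big1 ?addr0 => [|x xA]; last first.
  by rewrite ext0_out // mulr0.
by rewrite [RHS]big_sub; apply: eq_bigr => x _; rewrite ext0_val ffunE.
Qed.

Lemma lapE u : lap m1 w u = L u.
Proof. exact: linear_linfunE lap_fun_linear. Qed.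

Lemma lap_onE A u : lap_on m1 w A u = restr A (L (ext0 u)).
Proof.
apply: linear_linfunE => a v1 v2.
by rewrite ext0_linear lap_fun_linear restr_linear.
Qed.

Lemma dot_lap u v : dot (L u) v =
  2^-1 * \sum_x \sum_y w x y * ((u x - u y) * (v x - v y)).
Proof.
rewrite /dot; under eq_bigr do rewrite ffunE invr1 mul1r mulr_suml.
set S := LHS.
have S' : S = \sum_x \sum_y (u y - u x) * w x y * v y.
  rewrite /S exchange_big; apply: eq_bigr => x _; apply: eq_bigr => y _.
  by rewrite w_sym.
have : S + S = \sum_x \sum_y w x y * ((u x - u y) * (v x - v y)).
  rewrite {2}S' -big_split; apply: eq_bigr => x _ /=; rewrite -big_split.
  by apply: eq_bigr => y _ /=; ring.
by move=> <-; lra.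
Qed.

Lemma dot_lapC u v : dot (L u) v = dot u (L v).
Proof.
rewrite (dotC u) !dot_lap; congr (_ * _).
by apply: eq_bigr => x _; apply: eq_bigr => y _; rewrite (mulrC (u x - u y)).
Qed.

Lemma lap_self_adjoint : self_adjoint (lap m1 w).
Proof. by move=> u v; rewrite !lapE dot_lapC. Qed.

Lemma lap_on_self_adjoint A : self_adjoint (lap_on m1 w A).
Proof.
by move=> u v; rewrite !lap_onE dot_restr dot_lapC dotC -dot_restr dotC.
Qed.

(** The off-diagonal blocks of the Laplacian are minus the adjacency operators, as [ext0 u] vanishes
    at [x]. *)
Lemma offdiag A B (u : funs R (subV B)) (x : subV A) : [disjoint A & B] ->
  (m1 (val x))^-1 * \sum_(y : subV B) u y * w (val x) (val y)
  = - restr A (L (ext0 u)) x.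
Proof.
move=> dis; rewrite ffunE [X in _ = - X]ffunE -mulrN -sumrN; congr (_ * _).
rewrite (ext0_out u (x := val x)); last by rewrite (disjointFr dis) // (valP x).
rewrite [RHS](bigID (mem B)) /= [X in _ + X]big1 ?addr0 => [|y yB]; last first.
  by rewrite ext0_out // subrr mul0r oppr0.
rewrite [RHS]big_sub; apply: eq_bigr => y _.
by rewrite (ext0_val u y) sub0r mulNr opprK.
Qed.

Lemma adj_interiorE B u : adj_interior m1 w B u = - restr B (L (ext0 u)).
Proof.
have E (v : funs R (subV (~: B))) : [ffun x : subV B => (m1 (val x))^-1 *
    \sum_(y : subV (~: B)) v y * w (val x) (val y)] = - restr B (L (ext0 v)).
  by apply/ffunP => x; rewrite ffunE offdiag ?ffunE // -setI_eq0 setICr.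
rewrite -E; apply: linear_linfunE => a v1 v2.
by rewrite !E ext0_linear lap_fun_linear restr_linear opprD scalerN.
Qed.

Lemma adj_boundaryE B u : adj_boundary m1 w B u = - restr (~: B) (L (ext0 u)).
Proof.
have E (v : funs R (subV B)) : [ffun x : subV (~: B) => (m1 (val x))^-1 *
    \sum_(y : subV B) v y * w (val x) (val y)] = - restr (~: B) (L (ext0 v)).
  by apply/ffunP => x; rewrite ffunE offdiag ?ffunE // disjoint_sym -setI_eq0 setICr.
rewrite -E; apply: linear_linfunE => a v1 v2.
by rewrite !E ext0_linear lap_fun_linear restr_linear opprD scalerN.
Qed.

Section Schur.
Variable B : {set V}.
Hypothesis LB_inj : lker (boundary_lap m1 w B) == 0%VS.

Definition harmonic_part (u : funs R (subV (~: B))) : funs R (subV B) :=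
  (boundary_lap m1 w B)^-1%VF (adj_interior m1 w B u).

Lemma schur_opE u : schur_op m1 w B u = - restr (~: B) (L (ext0 (harmonic_part u))).
Proof. by rewrite !comp_lfunE /= adj_boundaryE. Qed.

Lemma harmonic_partE u :
  restr B (L (ext0 (harmonic_part u))) = - restr B (L (ext0 u)).
Proof.
by rewrite -lap_onE -adj_interiorE /harmonic_part lker0_lfunVK.
Qed.

Lemma dot_schur u v : dot (schur_op m1 w B u) v =
  dot (L (ext0 (harmonic_part u))) (ext0 (harmonic_part v)).
Proof.
rewrite schur_opE -scaleN1r dotZl mulN1r dot_restr dot_lapC dotC -dot_restr.
rewrite -[X in dot X _](opprK) -harmonic_partE -scaleN1r dotZl mulN1r opprK.
by rewrite dot_restr dot_lapC dotC.
Qed.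

Lemma schur_self_adjoint : self_adjoint (schur_op m1 w B).
Proof. by move=> u v; rewrite (dotC u) !dot_schur dot_lapC dotC. Qed.

Definition harmonic_ext : 'Hom(funs R (subV (~: B)), funs R V) :=
  linfun (fun u : funs R (subV (~: B)) => ext0 u + ext0 (harmonic_part u)).

Lemma harmonic_extE u : harmonic_ext u = ext0 u + ext0 (harmonic_part u).
Proof.
apply: linear_linfunE => a v1 v2.
by rewrite /harmonic_part !linearP /= !ext0_linear scalerDr addrACA.
Qed.

(** Both mixed terms equal minus the Schur form [S], so [D + S - 2 S] remains. *)
Lemma dot_lap_harmonic_ext u :
  dot (L (harmonic_ext u)) (harmonic_ext u) =
  dot (dirichlet_lap m1 w B u) u - dot (schur_op m1 w B u) u.
Proof.
rewrite harmonic_extE; set g := ext0 (harmonic_part u); set v := ext0 u.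
have -> : L (v + g) = L v + L g.
  by rewrite -[v in LHS]scale1r lap_fun_linear scale1r.
rewrite !(dotDl, dotDr) /dirichlet_lap lap_onE dot_restr -/v.
have -> : dot (schur_op m1 w B u) u = dot (L g) g by rewrite dot_schur.
have gv : dot (L g) v = - dot (L g) g.
  by rewrite -dot_schur schur_opE -scaleN1r dotZl mulN1r dot_restr opprK.
have -> : dot (L v) g = dot (L g) v by rewrite dot_lapC dotC.
rewrite gv; ring.
Qed.

Lemma dot_harmonic_ext u : dot u u <= dot (harmonic_ext u) (harmonic_ext u).
Proof.
rewrite harmonic_extE; set g := harmonic_part u.
have ug : dot (ext0 u) (ext0 g) = 0.
  rewrite /dot big1 // => x _; have [xB|xB] := boolP (x \in B).
    by rewrite ext0_out ?mul0r // inE xB.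
  by rewrite [X in _ * X]ext0_out ?mulr0.
rewrite !(dotDl, dotDr) (dotC (ext0 g)) ug addr0 add0r.
have -> : dot u u = dot (ext0 u) (ext0 u).
  by rewrite -dot_restr; congr dot; apply/ffunP => x; rewrite ffunE ext0_val.
by rewrite lerDl dot_ge0.
Qed.

End Schur.
End Operators.

(** Rank-nullity for [f] on the preimage and on the whole space. *)
Lemma codim_preim (R : realType) (S T : finType) (f : 'Hom(funs R S, funs R T))
    (W : {vspace funs R T}) q :
  codim_le W q -> codim_le (f @^-1: W) q.
Proof.
rewrite /codim_le -lpreim_cap_limg => dimW.
have := limg_ker_dim f (f @^-1: (W :&: limg f)).
rewrite lpreimK ?capvSr // (capv_idPr _); last by rewrite -lpreim0 lpreimS // sub0v.
have := limg_ker_dim f fullv; rewrite capfv dim_funs.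
have := dimv_sum_cap W (limg f); have := dimvS (subvf (W + limg f)); rewrite dim_funs.
move: dimW; move: (\dim (W + limg f)) (\dim (W :&: limg f)) (\dim W) (\dim (limg f)).
move: (\dim (lker f)) (\dim (f @^-1: (W :&: limg f))) #|S| #|T|.
clear; lia.
Qed.

(** * From a subspace of functions on the graph to a Dirichlet eigenvalue *)

Section UnitGraph.
Context (R : realType) (V : finType) (e : rel V).
Hypothesis e_sym : symmetric e.
Hypothesis e_conn : forall x y, connect e x y.
Local Notation m1 := (unit_measure R V).
Local Notation w := (unit_weight R e).
Local Notation L := (lap_fun m1 w).

Lemma unit_weight_sym x y : w x y = w y x.
Proof. by rewrite /unit_weight e_sym. Qed.

Lemma connectedT : connected e [set: V].
Proof.
move=> S _ /set0Pn[x xS] SV.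
have [y yS] : exists y, y \notin S.
  apply/existsP; apply: contraNT SV; rewrite negb_exists => /forallP h.
  by apply/eqP/setP => y; rewrite inE; apply/negPn/h.
have [/existsP[a /existsP[b /and3P[aS bS eab]]]|/existsPn h] :=
  boolP [exists a, exists b, [&& a \in S, b \notin S & e a b]].
  by exists a, b; rewrite !inE bS.
case/negP: yS; rewrite -(closed_connect _ (e_conn x y)) // => a b eab.
have step c d : e c d -> c \in S -> d \in S.
  move=> ecd cS; apply/negPn/negP => dS; have /existsPn/(_ d) := h c.
  by rewrite cS dS ecd.
by apply/idP/idP; apply: step; rewrite // e_sym.
Qed.

Lemma dot_lap_energy (u : funs R V) : dot (L u) u = energy e [set: V] u.
Proof.
rewrite (dot_lap unit_weight_sym) /energy; congr (_ * _).
apply: eq_big => [x|x _]; first by rewrite inE.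
by apply: eq_big => [y|y _]; [rewrite inE | rewrite -expr2].
Qed.

Lemma dot_sqnorm (u : funs R V) : dot u u = sqnorm [set: V] u.
Proof. by apply: eq_big => [x|x _]; rewrite ?inE // expr2. Qed.

(** A kernel vector extended by 0 has zero energy and vanishes at an interior vertex; an edge
    leaving its zero set would carry positive energy. *)
Lemma boundary_lap_inj B : ~: B != set0 -> lker (boundary_lap m1 w B) == 0%VS.
Proof.
case/set0Pn=> z zB; rewrite -subv0; apply/subvP => g; rewrite memv_ker memv0 => /eqP Lg.
have energy0 : energy e [set: V] (ext0 g) = 0.
  rewrite -dot_lap_energy -dot_restr -lap_onE.
  by rewrite -/(boundary_lap _ _ _) Lg /dot big1 // => x _; rewrite ffunE mul0r.
pose S := [set x | ext0 g x == 0].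
have zS : z \in S by rewrite inE ext0_out //; rewrite inE in zB.
suff ST : S = setT.
  apply/eqP/ffunP => x; rewrite [RHS]ffunE -ext0_val; apply/eqP.
  by have := in_setT (val x); rewrite -ST inE.
apply/eqP/negPn/negP => SN; have [||x [y [xS yS exy]]] := connectedT (S := S) _ _ SN.
- exact: subsetT.
- by apply/set0Pn; exists z.
rewrite inE in_setT andbT inE in yS; rewrite inE in xS.
have dis : [disjoint S & ~: S] by rewrite -setI_eq0 setICr.
have cross_le0 : cross e S (~: S) (ext0 g) <= 0.
  have := energy_setU e_sym (ext0 g) dis; rewrite setUCr energy0.
  have := energy_ge0 e S (ext0 g); have := energy_ge0 e (~: S) (ext0 g).
  by move: (energy _ _ _) (energy _ _ _) (cross _ _ _ _) => *; lra.
have := le_trans (cross_edge (C2 := ~: S) (ext0 g) (x := x) (y := y) _ _ exy) cross_le0.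
rewrite !inE (eqP xS) subr0 eqxx yS => /(_ isT isT).
by rewrite leNgt exprn_even_gt0 //= yS.
Qed.

(** Harmonic extension does not decrease the norm, so on the preimage of [W] the Dirichlet form
    minus the Schur form is at least [b] times the norm; [W'] bounds the Schur form below. The
    codimensions add up to [n.-1 + j.-1]. *)
Lemma lambdaD_ge B n j b (W : {vspace funs R V}) : 0 <= b -> (0 < n)%N -> (0 < j)%N ->
  (n.-1 + j <= #|~: B|)%N -> codim_le W n.-1 ->
  (forall u : funs R V, u \in W -> b * sqnorm [set: V] u <= energy e [set: V] u) ->
  b + eigval (schur_op m1 w B) j <= lambdaD m1 w B (n.-1 + j).
Proof.
move=> b_ge0 n_gt0 j_gt0 nj_le dimW hW.
have wS := unit_weight_sym.
have cardO : #|{: subV (~: B)}| = #|~: B| by rewrite card_sig.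
have LB : lker (boundary_lap m1 w B) == 0%VS.
  by apply: boundary_lap_inj; rewrite -card_gt0; lia.
have [|W' [dimW' hW']] := eigval_lower_subspace (schur_self_adjoint wS LB) (i := j).
  by rewrite cardO; lia.
apply: (eigval_ge (lap_on_self_adjoint wS (A := ~: B))
  (W := (harmonic_ext w B @^-1: W) :&: W')%VS).
- by rewrite cardO; lia.
- have -> : (n.-1 + j).-1 = (n.-1 + j.-1)%N by lia.
  by apply: codim_cap; first exact: codim_preim.
move=> u; rewrite memv_cap -memv_preim => /andP[/hW h1 /hW' h2].
rewrite -dot_sqnorm -dot_lap_energy (dot_lap_harmonic_ext wS LB) in h1.
have := ler_wpM2l b_ge0 (dot_harmonic_ext w u).
rewrite /dirichlet_lap in h1 *; lra.
Qed.

End UnitGraph.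

(** * Spectra of weighted paths *)

Section PathOperators.
Context (R : realType).

Lemma path_weight_sym n (c : R) (x y : 'I_n) : path_weight c x y = path_weight c y x.
Proof. by rewrite /path_weight /path_adj orbC minnC. Qed.

Lemma sum_successors n (G : nat -> nat -> R) :
  \sum_(x < n) \sum_(y < n | x.+1 == y :> nat) G x y = \sum_(0 <= l < n.-1) G l l.+1.
Proof.
case: n => [|n]; first by rewrite big_ord0 big_geq.
rewrite big_ord_recr /= [X in _ + X]big1 ?addr0 => [|y /eqP yE]; last first.
  by have := ltn_ord y; rewrite -yE ltnn.
rewrite big_mkord; apply: eq_bigr => x _.
have x_lt : (x.+1 < n.+1)%N by have := ltn_ord x.
by rewrite (big_pred1 (Ordinal x_lt)) // => y; rewrite /= eq_sym -val_eqE.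
Qed.

Lemma dot_lap_path n (c : R) (u : funs R 'I_n) (F : nat -> R) :
  (forall x, u x = F x) ->
  dot (lap_fun (unit_measure R 'I_n) (path_weight c) u) u =
  \sum_(0 <= l < n.-1) (if l == 0%N then c else 1) * (F l.+1 - F l) ^+ 2.
Proof.
move=> uF; rewrite dot_lap; last exact: path_weight_sym.
pose H (a b : nat) := (if minn a b == 0%N then c else 1) * (F a - F b) ^+ 2.
have HC a b : H a b = H b a by rewrite /H minnC -sqrrN opprB.
have -> : \sum_x \sum_y path_weight c x y * ((u x - u y) * (u x - u y)) =
    \sum_(x < n) \sum_(y < n | x.+1 == y :> nat) H x y +
    \sum_(x < n) \sum_(y < n | y.+1 == x :> nat) H x y.
  rewrite -big_split; apply: eq_bigr => x _ /=.
  rewrite [X in _ = X + _]big_mkcond [X in _ = _ + X]big_mkcond -big_split /=.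
  apply: eq_bigr => y _; rewrite /path_weight /path_adj !uF -expr2.
  have [xy|_] := eqVneq x.+1 (y : nat); have [yx|_] := eqVneq y.+1 (x : nat) => /=.
  - by exfalso; lia.
  - by rewrite addr0.
  - by rewrite add0r.
  - by rewrite mul0r addr0.
rewrite [X in _ + X](exchange_big_dep xpredT) //= sum_successors.
under [X in _ + X]eq_bigr do under eq_bigr do rewrite HC.
rewrite sum_successors; set S := \sum_(_ <= _ < _) _.
have -> : 2^-1 * (S + S) = S by field.
apply: eq_bigr => l _; rewrite /H (minn_idPl (leqnSn l)).
by rewrite -[(F l - _) ^+ 2]sqrrN opprB.
Qed.

Lemma sqnorm_ord n (u : funs R 'I_n) (F : nat -> R) : (forall x, u x = F x) ->
  dot u u = \sum_(0 <= l < n) F l ^+ 2.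
Proof. by move=> uF; rewrite big_mkord; apply: eq_bigr => x _; rewrite uF expr2. Qed.

(** An upper bound suffices, since [path_bound] is monotone in the weight of the first edge. *)
Lemma mu_path_le n : (2 <= n)%N -> mu_path R n n <= path_top R n.
Proof.
move=> n_ge2; rewrite /mu_path.
have -> : unit_weight R (@path_adj n) = path_weight 1.
  by apply: funext => x; apply: funext => y; rewrite /unit_weight /path_weight if_same; case: path_adj.
have [|u u_neq0] := eigval_eigenvector (lap_self_adjoint (@path_weight_sym n 1)) (i := n).
  by rewrite card_ord; lia.
rewrite lapE -/(mu _ _ _) => uE.
pose F l := if insub l is Some x then u x else 0 : R.
have uF x : u x = F x by rewrite /F -[nat_of_ord x]/(val x) valK.
have u_gt0 : 0 < dot u u by rewrite lt0r dot_eq0 u_neq0 dot_ge0.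
have := dot_lap_path 1 uF; rewrite uE dotZl => E.
rewrite -(ler_pM2r u_gt0) E (sqnorm_ord uF).
under eq_bigr do rewrite if_same mul1r.
have := @spring_energy R n n_ge2 F n.-1; rewrite spring_last // -mulrDr -big_nat_recr //=.
by rewrite prednK; [apply|]; lia.
Qed.

(** For the first eigenvalue the subspace has codimension 0, so every [v], extended by 0 at the
    boundary vertex, satisfies the bound. *)
Lemma path_bound_robin k (c : R) : (0 < k)%N ->
  path_bound c k
    (lambdaD (unit_measure R 'I_k.+1) (path_weight c) [set ord0] 1).
Proof.
move=> k_gt0 v; set B := [set ord0]; rewrite /lambdaD.
have wS := @path_weight_sym k.+1 c.
have cardO : #|{: subV (~: B)}| = k.
  by rewrite card_sig -[LHS]/#|~: B| cardsC1 card_ord.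
have [|W [dimW hW]] := eigval_lower_subspace
    (lap_on_self_adjoint wS (A := ~: B)) (i := 1).
  by rewrite cardO.
pose F l := if l is l'.+1 then v l' else 0.
pose u : funs R (subV (~: B)) := restr (~: B) ([ffun x : 'I_k.+1 => F x] : funs R _).
have uF x : ext0 u x = F x.
  have [xB|xB] := boolP (x \in ~: B); last first.
    by rewrite ext0_out //; move: xB; rewrite !inE negbK => /eqP ->.
  by rewrite -[x]/(val (Sub x xB : subV (~: B))) ext0_val !ffunE.
have uW : u \in W.
  suff -> : W = fullv by rewrite memvf.
  by apply/eqP; rewrite -(dimv_leqif_eq (subvf W)) eqn_leq dimvS ?subvf //= dim_funs; move: dimW; rewrite addn0.
have := hW u uW; rewrite lap_onE dot_restr (dot_lap_path c uF) /=.
have -> : dot u u = dot (ext0 u) (ext0 u).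
  by rewrite -dot_restr; congr dot; apply/ffunP => x; rewrite [RHS]ffunE ext0_val.
rewrite (sqnorm_ord uF) big_nat_recl //= expr0n add0r.
congr (_ <= _).
rewrite /path_energy -[in LHS](prednK k_gt0) big_nat_recl //= subr0; congr (_ + _).
by apply: eq_bigr => l _; rewrite mul1r.
Qed.

Lemma lambdaD_robin_ge0 k (c : R) : (0 < k)%N -> 0 <= c ->
  0 <= lambdaD (unit_measure R 'I_k.+1) (path_weight c) [set ord0] 1.
Proof.
move=> k_gt0 c_ge0; set B := [set ord0].
have wS := @path_weight_sym k.+1 c.
apply: (eigval_ge (lap_on_self_adjoint wS (A := ~: B)) (W := fullv)).
- by rewrite card_sig (_ : #|_| = #|~: B|) ?cardsC1 ?card_ord.
- by rewrite dim_funs addn0.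
move=> u _; rewrite mul0r lap_onE dot_restr dot_lap // mulr_ge0 ?invr_ge0 ?ler0n //.
apply: sumr_ge0 => x _; apply: sumr_ge0 => y _; rewrite -expr2 mulr_ge0 ?sqr_ge0 //.
by rewrite /path_weight; do 2?case: ifP.
Qed.

Lemma mu_path_ge0 n : (0 < n)%N -> 0 <= mu_path R n n.
Proof.
move=> n_gt0.
have wS x y : unit_weight R (@path_adj n) x y = unit_weight R (@path_adj n) y x.
  by rewrite /unit_weight /path_adj orbC.
apply: (eigval_ge (lap_self_adjoint wS) (W := fullv)).
- by rewrite card_ord n_gt0 leqnn.
- by rewrite dim_funs leq_addr.
move=> u _; rewrite mul0r lapE dot_lap // mulr_ge0 ?invr_ge0 ?ler0n //.
by apply: sumr_ge0 => x _; apply: sumr_ge0 => y _; rewrite -expr2 mulr_ge0 ?sqr_ge0.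
Qed.

End PathOperators.

(** * The two instances of the cutting argument *)

Section GraphBounds.
Context (R : realType) (V : finType) (e : rel V).
Hypothesis e_sym : symmetric e.
Hypothesis e_conn : forall x y, connect e x y.
Hypothesis V_gt0 : (0 < #|V|)%N.
Variable n : nat.
Hypothesis n_ge2 : (2 <= n)%N.

Let setT_neq0 : [set: V] != set0. Proof. by rewrite -card_gt0 cardsT. Qed.

(** Pieces have at most [k.+1] vertices and every cut pins a vertex, so one cut already gives
    potential 1. The strict bound on [#|V|] excludes the tight case. *)
Lemma subspace_bound_dirichlet k (b : R) : 0 <= b -> path_bound 1 k b ->
  (#|V| < n * k.+1)%N ->
  exists2 W : {vspace funs R V}, codim_le W n.-1 &
    forall u : funs R V, u \in W -> b * sqnorm [set: V] u <= energy e [set: V] u.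
Proof.
move=> b_ge0 hk V_lt.
apply: (@bound_subspace _ _ _ e_sym n k.+1 b (fun m => (0 < m)%N%:R) (fun=> 0)) => //.
- by move=> m /andP[-> _].
- by case=> [|a1] [|a2] _; rewrite ?addn0 ?add0n ?addr0 ?add0r // lerDl.
- move=> q D p z u a _ connD cD p_ge0 _ zD; rewrite mul0r => uz.
  have := zero_bound (K := k.+1) e_sym b_ge0 hk connD zD _ uz; rewrite cD => /(_ (leqnn _)).
  have : 0 <= \sum_(x in D) p x * u x ^+ 2.
    by apply: sumr_ge0 => x _; rewrite mulr_ge0 ?sqr_ge0.
  by rewrite uz sub0r sqrrN mul1r; lra.
- exact: connectedT.
- by rewrite cardsT ltnW.
by rewrite cardsT => V_eq; rewrite V_eq ltnn in V_lt.
Qed.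

Lemma subspace_bound_robin k (b c : R) : 0 <= b -> (0 < k)%N ->
  c <= path_top R n -> path_bound c k b -> #|V| = (n * k)%N ->
  exists2 W : {vspace funs R V}, codim_le W n.-1 &
    forall u : funs R V, u \in W -> b * sqnorm [set: V] u <= energy e [set: V] u.
Proof.
move=> b_ge0 k_gt0 c_le hk V_eq.
have top : path_bound (path_top R n) k b.
  by move=> v; apply: le_trans (hk v) _; rewrite lerD2r ler_wpM2r ?sqr_ge0.
have bound1 : path_bound 1 k.-1 b by apply: (@path_bound_shift _ c); rewrite prednK.
pose tau m : R := half_sine R n m.+1 / half_sine R n m.+2.
apply: (@bound_subspace _ _ _ e_sym n k b (spring R n) (fun m => - tau m)) => //.
- by rewrite spring0.
- by move=> m; apply: spring_ge1.
- by move=> a1 a2; apply: spring_sub.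
- move=> q D p z u a q_lt connD cD p_ge0 sump zD uz.
  have h1 : 0 < half_sine R n q.+1 by rewrite half_sine_gt0 //; lia.
  have h2 : 0 < half_sine R n q.+2 by rewrite half_sine_gt0 //; lia.
  have tau_gt0 : 0 < tau q by rewrite divr_gt0.
  have x_eq : path_top R n - spring R n q = 1 + (tau q)^-1.
    by rewrite spring_dual ?invf_div //; lia.
  have := connected_bound (p := fun x => p x + (1 + (tau q)^-1) * (x == z)%:R)
    e_sym u b_ge0 top connD.
  rewrite cD k_gt0 leqnn => /(_ isT); rewrite sum_indicator_sqr //.
  (* As [u z = - tau q * a], the edge energy splits into [1 + (tau q)^-1] times the square of [u z],
     which raises the potential of [D] to [path_top], and [1 + tau q], that is [spring q.+1], times
     the square of [a]. *)
  have -> : energy e D u + (\sum_(x in D) p x * u x ^+ 2 + (1 + (tau q)^-1) * u z ^+ 2) =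
     energy e D u + \sum_(x in D) p x * u x ^+ 2 + (u z - a) ^+ 2
     - spring R n q.+1 * a ^+ 2.
    rewrite uz /spring -/(tau q); move: (tau q) tau_gt0 => s s_gt0.
    by field; rewrite gt_eqF.
  rewrite lerBrDr; apply.
    by move=> x _; rewrite addr_ge0 // mulr_ge0 ?ler0n // addr_ge0 ?invr_ge0 ?ltW.
  by rewrite big_split /= sum_indicator // -x_eq; lra.
- exact: connectedT.
- by rewrite cardsT V_eq.
move=> _ D p u connD cD p_ge0; rewrite spring_last // => sump.
by apply: (connected_bound e_sym u b_ge0 top connD) => //; rewrite cD k_gt0 leqnn.
Qed.

End GraphBounds.

Theorem theorem6p7 (R : realType) (V : finType) (e : rel V) (B : {set V})
    (e_sym : symmetric e) (e_irr : irreflexive e)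
    (e_conn : forall x y : V, connect e x y) (B_neq0 : B != set0)
    (i j : nat) (i_ge2 : (2 <= i)%N) (i_le : (i <= #|~: B|)%N)
    (j_ge1 : (1 <= j)%N) (j_le : (j <= i - 1)%N) :
  let m := unit_measure R V in
  let w := unit_weight R e in
  let n := (i - j + 1)%N in
  let k := (#|V| %/ n)%N in
  (~~ (n %| #|V|)%N ->
    lambdaD m w B i >=
      2 * (1 - cos (pi / (2 * k + 1)%:R)) + eigval (schur_op m w B) j) /\
  ((n %| #|V|)%N ->
    lambdaD m w B i >=
      lambdaD (unit_measure R 'I_k.+1) (path_weight (mu_path R n n))
        [set ord0] 1
      + eigval (schur_op m w B) j).
Proof.
move=> m w n k.
have n_ge2 : (2 <= n)%N by rewrite /n; lia.
have V_ge : (#|~: B| <= #|V|)%N by apply: max_card.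
have n_le : (n <= #|V|)%N by rewrite /n; lia.
have k_gt0 : (0 < k)%N by rewrite divn_gt0 //; lia.
(* Of the [i.-1] conditions, [n.-1] come from cutting and [j.-1] from the Schur operator. *)
have iE : i = (n.-1 + j)%N by rewrite /n; lia.
have V_gt0 : (0 < #|V|)%N by lia.
split=> [_|/divnK V_eq].
  have b_ge0 : 0 <= 2 * (1 - cos (pi / (2 * k + 1)%:R)) :> R.
    by rewrite mulr_ge0 // subr_ge0 cos_le1.
  have [|W dimW hW] := subspace_bound_dirichlet e_sym e_conn V_gt0 n_ge2 b_ge0
      (path_bound_dirichlet k_gt0).
    by rewrite mulnC ltn_ceil //; lia.
  by rewrite iE; apply: lambdaD_ge dimW hW => //; lia.
have b_ge0 := lambdaD_robin_ge0 k_gt0 (mu_path_ge0 R (ltnW n_ge2)).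
have [|W dimW hW] := subspace_bound_robin e_sym e_conn V_gt0 n_ge2 b_ge0 k_gt0
    (mu_path_le R n_ge2) (path_bound_robin _ k_gt0).
  by rewrite mulnC -V_eq.
by rewrite iE; apply: lambdaD_ge dimW hW => //; lia.
Qed.
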